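(* Let $r,n,m\in\mathbb{N}$ with $m\leqslant n$, and let $B\in L_2$. Suppose that the Fourier coefficients of $B$ satisfy the following conditions. (1) For every integer $l$ with $1\leqslant l\leqslant m-1$ there exists $\gamma_l\in\mathbb{C}\setminus\{0\}$ such that $c_{-l-2nk}(B)=\gamma_l\,c_{l+2nk}(B)$ for all $k\in\mathbb{Z}$. (2) For every integer $l$ with $0\leqslant l\leqslant m-1$, $c_l(B)\ne0$. (3) For all $\nu\in\mathbb{Z}\setminus\{0\}$, $c_{2n\nu}(B)=0$. (4) For every integer $l$ with $1\leqslant l\leqslant m-1$, $$\sum_{k\in\mathbb{Z}}\frac{|c_{l+2nk}(B)|^2}{\frac{1}{(l+2nk)^{2r}}-\frac{1}{m^{2r}}}\geqslant0.$$ Then for every even function $u\in W^{(r)}_2$, $$E\bigl(u,\widetilde{\mathcal{S}}^1_{B,n,m}\bigr)_2\leqslant \frac{1}{m^r}\|u^{(r)}\|_2,$$ where $\widetilde{\mathcal{S}}^1_{B,n,m}=\mathrm{span}\,\{\Phi_{B,0}\}\oplus\mathrm{span}\,\{\Phi^e_{B,l}\}_{l=1}^{m-1}$.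
   Context: $\mathbb{N}=\{1,2,\dots\}$. $L_2$ is the space of (complex-valued) $2\pi$-periodic measurable functions that are square integrable over a period, with norm $\|f\|_2=\left(\int_{-\pi}^{\pi}|f|^2\right)^{1/2}$. $W^{(r)}_2$ is the space of $2\pi$-periodic functions $f$ such that $f^{(r-1)}$ is (locally) absolutely continuous and $f^{(r)}\in L_2$. For $\mathfrak{N}\subset L_2$, $E(f,\mathfrak{N})_2=\inf_{T\in\mathfrak{N}}\|f-T\|_2$. Fourier coefficients: $c_k(f)=\frac{1}{2\pi}\int_{-\pi}^{\pi}f(t)e^{-ikt}\,dt$. For $l\in\mathbb{Z}$, $$\Phi_{B,l}(x)=\Phi_{B,n,l}(x)=\frac{1}{2n}\sum_{j=0}^{2n-1}e^{\frac{ilj\pi}{n}}B\left(x-\frac{j\pi}{n}\right),$$ whose Fourier series is $\sum_{\nu\in\mathbb{Z}}c_{l+2n\nu}(B)e^{i(l+2n\nu)x}$. The even part of a function $f$ is $f^e=\frac{f+f(-\cdot)}{2}$, and $\Phi^e_{B,l}=(\Phi_{B,l})^e$. Linear spans are over $\mathbb{C}$; the span of the empty set is $\{0\}$. *)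

(* Defs.v *)
From HB Require Import structures.
From mathcomp Require Import all_boot all_order all_algebra.
From mathcomp Require Import complex.
From mathcomp Require Import all_classical all_reals all_analysis.

Set Implicit Arguments.
Unset Strict Implicit.
Unset Printing Implicit Defensive.
Import Order.TTheory GRing.Theory Num.Theory.
Import numFieldNormedType.Exports.

Local Open Scope classical_set_scope.
Local Open Scope ring_scope.
Local Open Scope complex_scope.

(* R carrying the sigma-algebra of Lebesgue (not just Borel) measurable sets *)
Definition lebesgueType (R : realType) :=
  caratheodory_type ((@wlength R idfun)^*)%mu.

Notation lebesgue := (@completed_lebesgue_measure _).

Definition period_itv (R : realType) : set (lebesgueType R) :=
  `[(- pi : R), (pi : R)]%classic.
Arguments period_itv {R}.

Definition periodic2pi (R : realType) (f : R -> R[i]) : Prop :=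
  forall x, f (x + 2 * pi) = f x.

Definition in_L2 (R : realType) (f : R -> R[i]) : Prop :=
  [/\ measurable_fun setT ((fun x => complex.Re (f x)) : lebesgueType R -> R),
      measurable_fun setT ((fun x => complex.Im (f x)) : lebesgueType R -> R),
      periodic2pi f &
      (\int[lebesgue]_(x in period_itv) ((Normc.normc (f x)) ^+ 2)%:E < +oo)%E].

(* real-valued: for f in L2 the integral is finite *)
Definition norm2 (R : realType) (f : R -> R[i]) : R :=
  Num.sqrt (\int[lebesgue]_(x in period_itv) ((Normc.normc (f x)) ^+ 2)).

Definition best_approx2 (R : realType) (f : R -> R[i])
    (N : set (R -> R[i])) : R :=
  inf [set norm2 (fun x => f x - T x) | T in N].

Definition cis (R : realType) (t : R) : R[i] := cos t +i* sin t.

Definition fourier (R : realType) (f : R -> R[i]) (k : int) : R[i] :=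
  let g t := f t * cis (- (k%:~R * t)) in
  ((2 * pi)^-1)%:C *
  ((\int[lebesgue]_(t in period_itv) complex.Re (g t))
     +i* (\int[lebesgue]_(t in period_itv) complex.Im (g t))).

(* R[i] is not a normed space over R in the libraries, so derivatives of a
   complex-valued function of a real variable are taken componentwise.  Where a
   derivative does not exist, derive1 takes a default value; for k = r and f in
   W^(r)_2 this happens only on a null set. *)
Definition cderiv (R : realType) (k : nat) (f : R -> R[i]) (x : R) : R[i] :=
  derive1n k (fun y => complex.Re (f y)) x
    +i* derive1n k (fun y => complex.Im (f y)) x.

Definition cderivable (R : realType) (f : R -> R[i]) (x : R) : Prop :=
  derivable (fun y => complex.Re (f y)) x 1 /\
  derivable (fun y => complex.Im (f y)) x 1.

Definition abs_continuous_on (R : realType) (a b : R) (f : R -> R[i]) : Prop :=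
  forall e : R, 0 < e -> exists2 d : R, 0 < d &
    forall (N : nat) (x y : 'I_N -> R),
      (forall i, [/\ a <= x i, x i <= y i & y i <= b]) ->
      (forall i j, i != j -> y i <= x j \/ y j <= x i) ->
      \sum_(i < N) (y i - x i) < d ->
      \sum_(i < N) Normc.normc (f (y i) - f (x i)) < e.

(* used for 0 < r *)
Definition in_W2 (R : realType) (r : nat) (f : R -> R[i]) : Prop :=
  [/\ periodic2pi f,
      forall (k : nat) (x : R), (k < r.-1)%N -> cderivable (cderiv k f) x,
      forall a b : R, a <= b -> abs_continuous_on a b (cderiv r.-1 f) &
      in_L2 (cderiv r f)].

Definition Phi (R : realType) (B : R -> R[i]) (n : nat) (l : int) (x : R) :
    R[i] :=
  ((2 * n)%N%:R)^-1 *
  \sum_(j < (2 * n)%N)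
    cis (l%:~R * j%:R * pi / n%:R) * B (x - j%:R * pi / n%:R).

Definition even_part (R : realType) (f : R -> R[i]) (x : R) : R[i] :=
  (f x + f (- x)) / 2.

Definition cspan (R : realType) (A : set (R -> R[i])) : set (R -> R[i]) :=
  [set f | exists (N : nat) (a : 'I_N -> R[i]) (v : 'I_N -> R -> R[i]),
     (forall i, A (v i)) /\ forall x, f x = \sum_(i < N) a i * v i x].

Definition subspace_sum (R : realType) (U V : set (R -> R[i])) :
    set (R -> R[i]) :=
  [set f | exists2 g, U g & exists2 h, V h & forall x, f x = g x + h x].

(* S1 as the sum of the two spans.  Its directness, when the Fourier conditions
   on B hold, comes from the summands having disjoint spectra; the best
   approximation only depends on the sum as a set. *)
Definition S1 (R : realType) (B : R -> R[i]) (n m : nat) : set (R -> R[i]) :=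
  subspace_sum
    (cspan [set Phi B n 0])
    (cspan [set even_part (Phi B n l) | l in [set l : int | 1 <= l <= m%:Z - 1]]).

(* The sum over all integers as the limit of symmetric partial sums; it is only
   applied to absolutely summable families. *)
Definition zsum (R : realType) (a : int -> R) : R :=
  limn (fun N : nat => \sum_(i < (2 * N).+1) a (i%:Z - N%:Z)).

(* Main.v *)
Require Import Defs.
From HB Require Import structures.
From mathcomp Require Import all_boot all_order all_algebra.
From mathcomp Require Import complex.
From mathcomp Require Import all_classical all_reals all_analysis.
From mathcomp Require Import measurable_realfun zify ring lra.
Import Order.TTheory GRing.Theory Num.Theory.
Import numFieldNormedType.Exports.
Local Open Scope classical_set_scope.
Local Open Scope ring_scope.
Local Open Scope complex_scope.

Set Implicit Arguments.
Unset Strict Implicit.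
Unset Printing Implicit Defensive.

(* Let [c_k] be the Fourier coefficients and [lam_k = k^(2r) / m^(2r)].  By
   Parseval and [c_k(u^(r)) = (i k)^r c_k(u)], it suffices to find [T] in the
   span with [sum_k |c_k(u) - c_k(T)|^2 <= sum_k lam_k |c_k(u)|^2], and this is
   done separately on each residue class of [k] modulo [2n].  Where [|k| >= m]
   on the whole class, [c_k(T) = 0] will do since [lam_k >= 1]; the class of [0]
   is matched at [k = 0] by [Phi_{B,0}].  On the class of [l], [0 < l < m], one
   has [c_k(T) = y_k := a c_k(B) / 2], and completing squares gives
     [lam_k |x|^2 - |x - y|^2 =
        |y|^2 / (lam_k^-1 - 1) + |(lam_k - 1) x + y|^2 / (lam_k - 1)].
   Choosing [a] so that the last square vanishes at [k = l], the only index of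
   the class with [lam_k < 1], condition (4) makes the sum over the class
   nonnegative.  Evenness of [u] transfers this to the class of [-l].

   Parseval holds because trigonometric polynomials are dense in L2: iterating
   [y |-> (3 y - y^3) / 2] on the values of a trigonometric polynomial with
   values in [-1, 1] gives bounded trigonometric polynomials converging to its
   sign, hence indicators of intervals are limits, and then all Borel sets by
   Dynkin's lemma.  Integration by parts for absolutely continuous functions
   comes from the Radon-Nikodym derivative of the Stieltjes measure of the
   total variation. *)

(** * Invariance of the completed Lebesgue measure *)

(** No infinite series is ever rearranged. Parseval is used in the form: up to [e], the squared norm
    is at most a sum over any finite set of frequencies that contains a fixed one. Such a set can be
    enlarged to a window of whole residue classes, each cut off symmetrically, so that only finite
    sums are compared. Condition (4) concerns a limit, but it descends to every symmetric partial
    sum, because all terms of the class except the one at [l] are nonpositive. The comparison cannot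
    be made frequency by frequency: one coefficient of [T] fixes all its values on a class, and the
    gain at [k = l] has to pay for the losses at the other frequencies; (4) says that it does. A
    second obstacle is the sigma-algebra: measurability is meant for Lebesgue sets, while uniqueness
    of measures, Dynkin's lemma and Stieltjes measures work on Borel sets. Every passage between the
    two writes a Lebesgue set as a Borel set together with a negligible one. *)

Lemma lebesgue_measurable_decomposition (R : realType) (A : set (lebesgueType R)) :
  measurable A -> exists X N : set R,
   [/\ measurable (X : set (measurableTypeR R)),
       (@lebesgue_measure R).-negligible N & A = X `|` N].
Proof.
move=> mA.
have : measurable_realfun.completed_algebra_gen (@lebesgue_measure R) A.
  by rewrite -g_sigma_completed_algebra_genE completed_caratheodory_measurable.
by move=> -[X mX [N nN <-]]; exists X, N.
Qed.

Lemma negligible_lebesgueE (R : realType) (N : set R) :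
  (@lebesgue_measure R).-negligible N -> (@completed_lebesgue_measure R).-negligible N.
Proof.
by move=> [A [mA A0 NA]]; exists A; split => //; exact: sub_caratheodory.
Qed.

Lemma negligible_lebesgue_measurable (R : realType) (N : set (lebesgueType R)) :
  (@lebesgue_measure R).-negligible N -> measurable N.
Proof.
move=> nN; apply: negligible_sub_caratheodory.
exact: negligible_lebesgueE.
Qed.

Section preserving.
Context (R : realType) (phi : R -> R).
Hypothesis mphi : measurable_fun setT (phi : measurableTypeR R -> measurableTypeR R).
Hypothesis phiE : forall a b : R, 
  (lebesgue_measure (phi @^-1` `]a, b]) = lebesgue_measure (`]a, b] : set R))%E.

(** The pushforward of Lebesgue measure by [phi] agrees with it on half-open intervals, and these
    determine it. *)
Lemma borel_preserving (A : set R) : measurable (A : set (measurableTypeR R)) ->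
  (lebesgue_measure (phi @^-1` A) = lebesgue_measure A)%E.
Proof.
move=> mA; apply/esym.
pose nu := measure_function_pushforward__canonical__measure_function_Measure
  (@lebesgue_measure R) mphi.
apply: (@lebesgue_measure_unique R nu _ A mA) => X.
by move=> /ocitvP[->|[[a b] /= _ ->]]; rewrite /nu /= /pushforward ?preimage_set0 ?phiE.
Qed.

Lemma preserving_negligible (N : set R) :
  (@lebesgue_measure R).-negligible N -> (@lebesgue_measure R).-negligible (phi @^-1` N).
Proof.
move=> [A [mA A0 NA]]; exists (phi @^-1` A); split.
- by rewrite -[X in measurable X]setTI; exact: mphi.
- by rewrite borel_preserving.
- by move=> x /NA.
Qed.

(** Borel measurability of [phi] alone would not do here: preimages of negligible sets must be
    negligible, which is where preservation of the measure enters. *)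
Lemma lebesgue_preserving_measurable :
  measurable_fun setT (phi : lebesgueType R -> lebesgueType R).
Proof.
move=> _ A /lebesgue_measurable_decomposition[X [N [mX nN ->]]].
rewrite setTI preimage_setU; apply: measurableU.
  by apply: sub_caratheodory; rewrite -[X in measurable X]setTI; exact: mphi.
exact/negligible_lebesgue_measurable/preserving_negligible.
Qed.

Lemma lebesgue_preserving (A : set (lebesgueType R)) : measurable A ->
  (completed_lebesgue_measure (phi @^-1` A) = completed_lebesgue_measure A)%E.
Proof.
move=> /lebesgue_measurable_decomposition[X [N [mX nN ->]]].
rewrite preimage_setU.
have mu0 (M : set (lebesgueType R)) : (@lebesgue_measure R).-negligible M ->
    (completed_lebesgue_measure M = 0)%E.
  move=> nM; apply/negligibleP; last exact: negligible_lebesgueE.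
  exact: negligible_lebesgue_measurable.
have U (Y M : set (lebesgueType R)) : measurable (Y : set (measurableTypeR R)) ->
    (@lebesgue_measure R).-negligible M ->
    (completed_lebesgue_measure (Y `|` M) = lebesgue_measure Y)%E.
  move=> mY nM; apply: measureU0; last exact: mu0.
    exact: sub_caratheodory.
  exact: negligible_lebesgue_measurable.
rewrite !U//; first exact: borel_preserving.
  by rewrite -[X in measurable X]setTI; exact: mphi.
exact: preserving_negligible.
Qed.

Lemma ge0_lebesgue_preserving_integral (D : set (lebesgueType R))
    (f : lebesgueType R -> \bar R) :
  measurable D -> measurable_fun D f -> {in D, forall y, (0 <= f y)%E} ->
  (\int[lebesgue]_(x in phi @^-1` D) f (phi x) = \int[lebesgue]_(x in D) f x)%E.
Proof.
move=> mD mf f0.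
rewrite -(ge0_integral_pushforward lebesgue_preserving_measurable)//.
apply: eq_measure_integral => [|? A mA AD]; last exact: lebesgue_preserving.
exact: lebesgue_preserving_measurable.
Qed.

End preserving.

Section translation.
Context (R : realType).
Implicit Types (s : R) (f : lebesgueType R -> \bar R).

Lemma measurable_subr s :
  measurable_fun setT ((fun x => x - s) : measurableTypeR R -> measurableTypeR R).
Proof.
by apply: continuous_measurable_fun => x; apply: cvgB; [exact: cvg_id|exact: cvg_cst].
Qed.

Lemma lebesgue_subr s (a b : R) :
  (lebesgue_measure ((fun x => x - s)%R @^-1` `]a, b]) = lebesgue_measure (`]a, b] : set R))%E.
Proof.
rewrite (_ : _ @^-1` _ = `]a + s, b + s]%classic); last first.
  by apply/seteqP; split => x /=; rewrite !in_itv/= ltrBrDr lerBlDr.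
rewrite !lebesgue_measure_itv/= !lte_fin ltrD2r; case: ifPn => // _.
by rewrite -!EFinD; congr EFin; ring.
Qed.

Lemma measurable_oppR :
  measurable_fun setT (-%R : measurableTypeR R -> measurableTypeR R).
Proof. by apply: continuous_measurable_fun => x; exact: opp_continuous. Qed.

Lemma lebesgue_oppr (a b : R) :
  (lebesgue_measure (-%R @^-1` `]a, b]) = lebesgue_measure (`]a, b] : set R))%E.
Proof.
rewrite (_ : _ @^-1` _ = `[- b, - a[%classic); last first.
  by apply/seteqP; split => x /=; rewrite !in_itv/= lerNl ltrNr andbC.
rewrite !lebesgue_measure_itv/= !lte_fin ltrN2; case: ifPn => // _.
by rewrite -!EFinD; congr EFin; rewrite opprK addrC.
Qed.

Lemma measurable_fun_comp_subr s d' (U : measurableType d') (f : lebesgueType R -> U) :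
  measurable_fun setT f ->
  measurable_fun setT ((fun x => f (x - s)) : lebesgueType R -> U).
Proof.
move=> mf; apply: (measurableT_comp mf).
exact: (lebesgue_preserving_measurable (measurable_subr s) (lebesgue_subr s)).
Qed.

Lemma measurable_fun_comp_oppr d' (U : measurableType d') (f : lebesgueType R -> U) :
  measurable_fun setT f ->
  measurable_fun setT ((fun x => f (- x)) : lebesgueType R -> U).
Proof.
move=> mf; apply: (measurableT_comp mf).
exact: (lebesgue_preserving_measurable measurable_oppR lebesgue_oppr).
Qed.

Lemma measurable_lebesgue_itv (i : interval R) : measurable ([set` i] : set (lebesgueType R)).
Proof. by apply: sub_caratheodory; exact: measurable_itv. Qed.

Lemma measurable_period_itv : measurable (@period_itv R).
Proof. exact: measurable_lebesgue_itv. Qed.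

Lemma lebesgue_set1 (x : R) : (completed_lebesgue_measure [set x] = 0)%E.
Proof. exact: (lebesgue_measure_set1 x). Qed.

(** Half-open intervals can be cut and translated without overlaps; the lost endpoint is a null
    set. *)
Lemma period_itv_bndo f : measurable_fun setT f -> (forall x, 0 <= f x)%E ->
  (\int[lebesgue]_(x in period_itv) f x = \int[lebesgue]_(x in `[(- pi)%R, (pi : R)[%classic) f x)%E.
Proof.
move=> mf f0.
have := @ge0_negligible_integral _ (lebesgueType R) R (@completed_lebesgue_measure R) period_itv [set (pi : R)] f.
move=> ->//.
- congr integral; apply/seteqP; split => x; rewrite /period_itv/= !in_itv/=.
    by move=> [/andP[px xp] /eqP xpi]; rewrite px lt_neqAle xpi.
  by move=> /andP[px xp]; split; [rewrite px ltW|apply/eqP; rewrite lt_eqF].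
- rewrite (_ : [set _] = `[(pi : R), (pi : R)]%classic).
    exact: measurable_lebesgue_itv.
  by rewrite set_itv1.
- exact: measurable_period_itv.
- exact: measurable_funTS.
- exact: lebesgue_set1.
Qed.

(** Translation turns the left side into the integral of [f] over [[-pi - s, pi - s[]. The part left
    of [-pi] is moved by [2 * pi] onto [[pi - s, pi[]; the bounds on [s] keep both cutting points
    inside. *)
Lemma ge0_period_shift s f : 0 <= s <= 2 * pi -> measurable_fun setT f ->
  (forall x, 0 <= f x)%E -> (forall x : R, f (x + 2 * pi)%R = f x) ->
  (\int[lebesgue]_(x in period_itv) f (x - s)%R = \int[lebesgue]_(x in period_itv) f x)%E.
Proof.
move=> /andP[s0 s2] mf f0 fp.
have shift t (a b : R) :
    (\int[lebesgue]_(x in `[(a + t)%R, (b + t)%R[%classic) f (x - t)%R =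
     \int[lebesgue]_(x in `[a, b[%classic) f x)%E.
  rewrite -[RHS](ge0_lebesgue_preserving_integral (measurable_subr t) (lebesgue_subr t))//.
  - congr integral; apply/seteqP; split => x /=; rewrite !in_itv/=.
      by rewrite lerBrDr ltrBlDr.
    by rewrite lerBrDr ltrBlDr.
  - exact: measurable_lebesgue_itv.
  - exact: measurable_funTS.
have split (a b c : R) : a <= b -> b <= c ->
    (\int[lebesgue]_(x in `[a, c[%classic) f x =
     \int[lebesgue]_(x in `[a, b[%classic) f x + \int[lebesgue]_(x in `[b, c[%classic) f x)%E.
  move=> ab bc.
  rewrite (@itv_bndbnd_setU _ _ (BLeft a) (BLeft b) (BLeft c)) ?bnd_simp//.
  rewrite ge0_integral_setU//.
  - exact: measurable_lebesgue_itv.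
  - exact: measurable_lebesgue_itv.
  - exact: measurable_funTS.
  apply/disj_setPS => x /= []; rewrite !in_itv/= => /andP[_ xb] /andP[bx _].
  by move: (lt_le_trans xb bx); rewrite ltxx.
rewrite !period_itv_bndo//; last exact: measurable_fun_comp_subr.
(* Both endpoints are written as [(_ - s) + s], the form in which [shift] applies. *)
rewrite -[X in `[X, _[%classic](subrK s) -[X in `[_, X[%classic](subrK s) shift !subrK.
rewrite (split _ (- pi)) ?lerBlDr ?lerDl//; last by rewrite -subr_ge0; lra.
rewrite [RHS](split _ (pi - s)) ?lerBlDr ?lerDl//; last by rewrite -subr_ge0; lra.
rewrite addeC; congr (_ + _)%E.
rewrite -(shift (2 * pi) (- pi - s)).
rewrite (_ : - pi - s + 2 * pi = pi - s); last by ring.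
rewrite (_ : - pi + 2 * pi = pi :> R); last by ring.
by apply: eq_integral => x _; rewrite -[in RHS](subrK (2 * pi) x) fp.
Qed.

Lemma period_shift s f : 0 <= s <= 2 * pi -> measurable_fun setT f ->
  (forall x : R, f (x + 2 * pi)%R = f x) ->
  (\int[lebesgue]_(x in period_itv) f (x - s)%R = \int[lebesgue]_(x in period_itv) f x)%E.
Proof.
move=> s2 mf fp; rewrite integralE [RHS]integralE; congr (_ - _)%E.
- rewrite -(@ge0_period_shift s f^\+%E)//.
  + by apply: eq_integral => x _; rewrite ?funeposE ?funenegE.
  + exact: measurable_funepos.
  + by move=> x; rewrite !funeposE fp.
- rewrite -(@ge0_period_shift s f^\-%E)//.
  + by apply: eq_integral => x _; rewrite ?funeposE ?funenegE.
  + exact: measurable_funeneg.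
  + by move=> x; rewrite !funenegE fp.
Qed.

Lemma period_reflect f : measurable_fun setT f ->
  (\int[lebesgue]_(x in period_itv) f (- x)%R = \int[lebesgue]_(x in period_itv) f x)%E.
Proof.
have H (g : lebesgueType R -> \bar R) : measurable_fun setT g -> (forall x, 0 <= g x)%E ->
    (\int[lebesgue]_(x in period_itv) g (- x)%R = \int[lebesgue]_(x in period_itv) g x)%E.
  move=> mg g0.
  rewrite -[RHS](ge0_lebesgue_preserving_integral measurable_oppR lebesgue_oppr)//.
  - congr integral; apply/seteqP; split => x /=; rewrite /period_itv/= !in_itv/=.
      by rewrite lerN2 lerNl andbC.
    by rewrite lerN2 lerNl andbC.
  - exact: measurable_period_itv.
  - exact: measurable_funTS.
move=> mf; rewrite integralE [RHS]integralE; congr (_ - _)%E.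
- rewrite -(H f^\+%E)//; first by apply: eq_integral => x _; rewrite ?funeposE ?funenegE.
  exact: measurable_funepos.
- rewrite -(H f^\-%E)//; first by apply: eq_integral => x _; rewrite ?funeposE ?funenegE.
  exact: measurable_funeneg.
Qed.

End translation.

(** * Square integrable functions over a period *)

Section complex_facts.
Context (R : rcfType).
Implicit Types z w : R[i].

Lemma ReD z w : complex.Re (z + w) = complex.Re z + complex.Re w.
Proof. by case: z; case: w. Qed.
Lemma ImD z w : complex.Im (z + w) = complex.Im z + complex.Im w.
Proof. by case: z; case: w. Qed.
Lemma ReN z : complex.Re (- z) = - complex.Re z.
Proof. by case: z. Qed.
Lemma ImN z : complex.Im (- z) = - complex.Im z.
Proof. by case: z. Qed.
Lemma ReMc z w : complex.Re (z * w) =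
  complex.Re z * complex.Re w - complex.Im z * complex.Im w.
Proof. by case: z; case: w. Qed.
Lemma ImMc z w : complex.Im (z * w) =
  complex.Re z * complex.Im w + complex.Im z * complex.Re w.
Proof. by case: z => a b; case: w => c d /=; rewrite addrC. Qed.

Lemma eq_complexP z w :
  complex.Re z = complex.Re w -> complex.Im z = complex.Im w -> z = w.
Proof. by case: z; case: w => /= a b c d -> ->. Qed.

Lemma normc_sq z : Normc.normc z ^+ 2 = complex.Re z ^+ 2 + complex.Im z ^+ 2.
Proof. by case: z => a b /=; rewrite sqr_sqrtr// addr_ge0// sqr_ge0. Qed.

Lemma normc_sqD z w :
  Normc.normc (z + w) ^+ 2 <= 2 * Normc.normc z ^+ 2 + 2 * Normc.normc w ^+ 2.
Proof.
rewrite !normc_sq ReD ImD -subr_ge0.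
set a := complex.Re z; set b := complex.Im z; set c := complex.Re w; set d := complex.Im w.
rewrite (_ : _ - _ = (a - c) ^+ 2 + (b - d) ^+ 2); last by ring.
by rewrite addr_ge0// sqr_ge0.
Qed.

Lemma normc_sqM z w :
  Normc.normc (z * w) ^+ 2 = Normc.normc z ^+ 2 * Normc.normc w ^+ 2.
Proof. by rewrite Normc.normcM exprMn. Qed.

End complex_facts.

Section cis_facts.
Context (R : realType).
Implicit Types x y : R.

Lemma cisD x y : cis (x + y) = cis x * cis y.
Proof.
apply: eq_complexP; rewrite ?ReMc ?ImMc /= ?cosD ?sinD//.
by rewrite [RHS]addrC.
Qed.

Lemma cis0 : cis (0 : R) = 1.
Proof. by rewrite /cis cos0 sin0. Qed.

Lemma normc_sq_cis x : Normc.normc (cis x) ^+ 2 = 1.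
Proof. by rewrite normc_sq /= cos2Dsin2. Qed.

Lemma cis_2pi x : cis (x + 2 * pi) = cis x.
Proof.
rewrite /cis; congr (_ +i* _).
  by rewrite mulr_natl cosD2pi.
by rewrite mulr_natl sinD2pi.
Qed.

Lemma cis_2pin x (n : nat) : cis (x + n%:R * (2 * pi)) = cis x.
Proof.
elim: n => [|n IH]; first by rewrite mul0r addr0.
by rewrite -natr1 mulrDl mul1r addrA cis_2pi.
Qed.

Lemma cis_2pik x (k : int) : cis (x + k%:~R * (2 * pi)) = cis x.
Proof.
case: (intP k) => [|n|n]; first by rewrite mul0r addr0.
  by rewrite -[in RHS](cis_2pin x n.+1).
rewrite -[in LHS](cis_2pin _ n.+1) mulrNz mulNr subrK//.
Qed.

Lemma cis_periodic (k : int) : periodic2pi (fun x : R => cis (k%:~R * x)).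
Proof. by move=> x; rewrite mulrDr cis_2pik. Qed.

End cis_facts.

Section csqint.
Context (R : realType).
Local Notation T := (lebesgueType R).
Local Notation C := R[i].
Implicit Types (f g h : R -> C) (a z : C) (p q : R -> R).

Record cmeasurable f : Prop := CMeasurable {
  cmeasurable_Re : measurable_fun setT ((fun x => complex.Re (f x)) : T -> R);
  cmeasurable_Im : measurable_fun setT ((fun x => complex.Im (f x)) : T -> R) }.

Definition sqdist f g : \bar R :=
  (\int[lebesgue]_(x in period_itv) ((Normc.normc (f x - g x)) ^+ 2)%:E)%E.

(** Periodicity is kept apart from square integrability, since it matters only for translations. *)
Record csqint f : Prop := CSqint {
  csqint_measurable : cmeasurable f;
  csqint_lty :
    (\int[lebesgue]_(x in period_itv) ((Normc.normc (f x)) ^+ 2)%:E < +oo)%E }.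

Record pintegrable p : Prop := PIntegrable { pintegrable_integrable :
  (@completed_lebesgue_measure R).-integrable period_itv (EFin \o (p : T -> R)) }.

Definition pint p : R := \int[lebesgue]_(x in period_itv) p x.

Definition cint f : C := pint (fun x => complex.Re (f x)) +i* pint (fun x => complex.Im (f x)).

Record cintegrable f : Prop := CIntegrable {
  cintegrable_Re : pintegrable (fun x => complex.Re (f x));
  cintegrable_Im : pintegrable (fun x => complex.Im (f x)) }.

Lemma in_L2P f : in_L2 f <-> csqint f /\ periodic2pi f.
Proof. by split=> [[a b c d]|[[[a b] d] c]]; split=> //; split. Qed.

Lemma continuous_lebesgue_measurable p : (continuous (p : R -> R^o)) ->
  measurable_fun setT (p : T -> R).
Proof.
move=> cp _ A mA; apply: sub_caratheodory.
exact: (continuous_measurable_fun cp).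
Qed.

Lemma cmeasurableD f g : cmeasurable f -> cmeasurable g ->
  cmeasurable (fun x => f x + g x).
Proof.
move=> [a b] [c d]; split; under eq_fun do rewrite ?ReD ?ImD;
  exact: measurable_funD.
Qed.

Lemma cmeasurableM f g : cmeasurable f -> cmeasurable g ->
  cmeasurable (fun x => f x * g x).
Proof.
move=> [a b] [c d]; split; under eq_fun do rewrite ?ReMc ?ImMc.
  by apply: measurable_funB; exact: measurable_funM.
by apply: measurable_funD; exact: measurable_funM.
Qed.

Lemma cmeasurable_cst z : cmeasurable (fun=> z).
Proof. by split; exact: measurable_cst. Qed.

Lemma cmeasurableZ z f : cmeasurable f -> cmeasurable (fun x => z * f x).
Proof. by move=> mf; exact: (cmeasurableM (cmeasurable_cst z) mf). Qed.

Lemma cmeasurableN f : cmeasurable f -> cmeasurable (fun x => - f x).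
Proof.
move=> mf; rewrite (_ : (fun x => - f x) = (fun x => -1 * f x)).
  exact: cmeasurableZ.
by apply/funext => x; rewrite mulN1r.
Qed.

Lemma cmeasurableB f g : cmeasurable f -> cmeasurable g ->
  cmeasurable (fun x => f x - g x).
Proof. by move=> mf mg; exact: (cmeasurableD mf (cmeasurableN mg)). Qed.

Lemma cmeasurable_cis (c : R) : cmeasurable (fun x => cis (c * x)).
Proof.
split; apply: continuous_lebesgue_measurable => x /=.
  apply: (@continuous_comp _ _ _ (fun x => c * x) (@cos R)); last exact: continuous_cos.
  exact: mulrl_continuous.
apply: (@continuous_comp _ _ _ (fun x => c * x) (@sin R)); last exact: continuous_sin.
exact: mulrl_continuous.
Qed.

Lemma measurable_normc_sq f : cmeasurable f ->
  measurable_fun setT ((fun x => Normc.normc (f x) ^+ 2) : T -> R).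
Proof.
move=> [a b]; under eq_fun do rewrite normc_sq.
by apply: measurable_funD; exact: measurable_funX.
Qed.

Lemma measurable_normc_sqE f : cmeasurable f ->
  measurable_fun setT ((fun x => (Normc.normc (f x) ^+ 2)%:E) : T -> \bar R).
Proof. by move=> mf; apply/measurable_EFinP; exact: measurable_normc_sq. Qed.

Lemma pintegrable_normc_sq f : csqint f -> pintegrable (fun x => Normc.normc (f x) ^+ 2).
Proof.
move=> [mf fi]; split; apply/integrableP; split.
  by apply/measurable_EFinP; apply: measurable_funTS; exact: measurable_normc_sq.
apply: le_lt_trans fi; rewrite le_eqVlt; apply/orP; left; apply/eqP.
by apply: eq_integral => x _ /=; rewrite ger0_norm// sqr_ge0.
Qed.

Lemma lebesgue_period_itv : (completed_lebesgue_measure (@period_itv R) = (2 * pi)%:E)%E.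
Proof.
have := @lebesgue_measure_itv R `[- pi, pi].
rewrite /= lte_fin gtrN ?pi_gt0// => /= E; apply: etrans E _.
by rewrite -EFinD; congr EFin; ring.
Qed.

Lemma pintegrable_cst (c : R) : pintegrable (fun=> c).
Proof.
split; apply: measurable_bounded_integrable.
- exact: measurable_period_itv.
- by rewrite [ltLHS]lebesgue_period_itv ltry.
- exact: measurable_cst.
- by exists `|c|; split => // M cM x _; apply: ltW.
Qed.

Lemma pint_cst (c : R) : pint (fun=> c) = c * (2 * pi).
Proof.
rewrite /pint Rintegral_cst; last exact: measurable_period_itv.
by rewrite [fine _](_ : _ = fine (2 * pi)%:E)// [X in fine X]lebesgue_period_itv.
Qed.

Lemma pintegrableD p q : pintegrable p -> pintegrable q -> pintegrable (fun x => p x + q x).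
Proof. by move=> [ip] [iq]; split; move: (integrableD (@measurable_period_itv R) ip iq); exact: eq_integrable (@measurable_period_itv R) _ _ _. Qed.

Lemma pintegrableZ (c : R) p : pintegrable p -> pintegrable (fun x => c * p x).
Proof. by move=> [ip]; split; move: (integrableZl (@measurable_period_itv R) c ip); exact: eq_integrable (@measurable_period_itv R) _ _ _. Qed.

Lemma pintegrableB p q : pintegrable p -> pintegrable q -> pintegrable (fun x => p x - q x).
Proof. by move=> [ip] [iq]; split; move: (integrableB (@measurable_period_itv R) ip iq); exact: eq_integrable (@measurable_period_itv R) _ _ _. Qed.

Lemma pintD p q : pintegrable p -> pintegrable q ->
  pint (fun x => p x + q x) = pint p + pint q.
Proof. by move=> [ip] [iq]; exact: (RintegralD (@measurable_period_itv R) ip iq). Qed.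

Lemma pintB p q : pintegrable p -> pintegrable q ->
  pint (fun x => p x - q x) = pint p - pint q.
Proof. by move=> [ip] [iq]; exact: (RintegralB (@measurable_period_itv R) ip iq). Qed.

Lemma pintZ (c : R) p : pintegrable p -> pint (fun x => c * p x) = c * pint p.
Proof. by move=> [ip]; exact: (RintegralZl _ (@measurable_period_itv R) ip). Qed.

Lemma pintegrable_le p q : measurable_fun setT (p : T -> R) ->
  (forall x, `|p x| <= q x) -> pintegrable q -> pintegrable p.
Proof.
move=> mp pq [iq]; split; move: iq; apply: le_integrable.
- exact: measurable_period_itv.
- by apply/measurable_EFinP; exact: measurable_funTS.
- by move=> x _ /=; rewrite lee_fin (le_trans (pq x))// ler_norm.
Qed.

Lemma csqint_le (c : R) f g h : cmeasurable h ->
  (forall x, Normc.normc (h x) ^+ 2 <=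
     c * (Normc.normc (f x) ^+ 2 + Normc.normc (g x) ^+ 2)) ->
  csqint f -> csqint g -> csqint h.
Proof.
move=> mh hfg If Ig; split => //.
have [/integrableP[_]] : pintegrable (fun x => Normc.normc (h x) ^+ 2).
  apply: (@pintegrable_le _ (fun x =>  c * (Normc.normc (f x) ^+ 2 + Normc.normc (g x) ^+ 2))).
  - exact: measurable_normc_sq.
  - by move=> x; rewrite ger0_norm// sqr_ge0.
  - by apply: pintegrableZ; apply: pintegrableD; exact: pintegrable_normc_sq.
apply: le_lt_trans; rewrite le_eqVlt; apply/orP; left; apply/eqP.
by apply: eq_integral => x _ /=; rewrite ger0_norm// sqr_ge0.
Qed.

Lemma csqintD f g : csqint f -> csqint g -> csqint (fun x => f x + g x).
Proof.
move=> If Ig; apply: (@csqint_le 2 f g _ _ _ If Ig).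
  exact: (cmeasurableD (csqint_measurable If) (csqint_measurable Ig)).
by move=> x; rewrite mulrDr normc_sqD.
Qed.

Lemma csqint_cst z : csqint (fun=> z).
Proof.
split; first exact: cmeasurable_cst.
have [/integrableP[_]] := pintegrable_cst (Normc.normc z ^+ 2).
apply: le_lt_trans; rewrite le_eqVlt; apply/orP; left; apply/eqP.
by apply: eq_integral => x _ /=; rewrite ger0_norm// sqr_ge0.
Qed.

Lemma csqintZ z f : csqint f -> csqint (fun x => z * f x).
Proof.
move=> If; apply: (@csqint_le (Normc.normc z ^+ 2) f f _ _ _ If If).
  exact: (cmeasurableZ z (csqint_measurable If)).
move=> x; rewrite normc_sqM ler_wpM2l ?sqr_ge0// lerDl sqr_ge0//.
Qed.

Lemma csqintN f : csqint f -> csqint (fun x => - f x).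
Proof.
move=> If; rewrite (_ : (fun x => - f x) = (fun x => -1 * f x)).
  exact: csqintZ.
by apply/funext => x; rewrite mulN1r.
Qed.

Lemma csqintB f g : csqint f -> csqint g -> csqint (fun x => f x - g x).
Proof. by move=> If Ig; exact: (csqintD If (csqintN Ig)). Qed.

Lemma csqintM_cis (c : R) f : csqint f -> csqint (fun x => f x * cis (c * x)).
Proof.
move=> If; apply: (@csqint_le 1 f f _ _ _ If If).
  exact: (cmeasurableM (csqint_measurable If) (cmeasurable_cis c)).
by move=> x; rewrite normc_sqM normc_sq_cis mulr1 mul1r lerDl sqr_ge0.
Qed.

Lemma csqint_cis (c : R) : csqint (fun x => cis (c * x)).
Proof.
rewrite (_ : (fun _ => _) = (fun x => 1 * cis (c * x))).
  by apply: csqintM_cis; exact: csqint_cst.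
by apply/funext => x; rewrite mul1r.
Qed.

(** A period has finite measure and [|t| <= 1 + t ^+ 2], so the constant 1 plus the squared modulus
    dominates both components. *)
Lemma csqint_integrable f : csqint f -> cintegrable f.
Proof.
move=> If; have [[mr mi] _] := If.
have I1 : pintegrable (fun x => 1 + Normc.normc (f x) ^+ 2).
  by apply: pintegrableD; [exact: pintegrable_cst|exact: pintegrable_normc_sq].
have H (t : R) : `|t| <= 1 + t ^+ 2.
  have := sqr_ge0 (`|t| - 1); have := normr_ge0 t; rewrite -(real_normK (num_real t)).
  by move: `|t| => s; nra.
split; apply: (@pintegrable_le _ _ _ _ I1) => // x; rewrite normc_sq.
  by rewrite (le_trans (H _))// addrA lerDl sqr_ge0.
by rewrite (le_trans (H _))// addrA lerD2r lerDl sqr_ge0.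
Qed.

Lemma cintD f g : cintegrable f -> cintegrable g ->
  cint (fun x => f x + g x) = cint f + cint g.
Proof.
move=> [a b] [c d]; apply: eq_complexP; rewrite ?ReD ?ImD /= /cint /=.
  by under eq_fun do rewrite ReD; exact: pintD.
by under eq_fun do rewrite ImD; exact: pintD.
Qed.

Lemma cintZ z f : cintegrable f -> cint (fun x => z * f x) = z * cint f.
Proof.
move=> [a b]; apply: eq_complexP; rewrite ?ReMc ?ImMc /= /cint /=.
  under eq_fun do rewrite ReMc; rewrite pintB ?pintZ//; exact: pintegrableZ.
under eq_fun do rewrite ImMc; rewrite pintD ?pintZ//; exact: pintegrableZ.
Qed.

Lemma pint_shift (s : R) p : 0 <= s <= 2 * pi -> measurable_fun setT (p : T -> R) ->
  (forall x, p (x + 2 * pi) = p x) -> pint (fun x => p (x - s)) = pint p.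
Proof.
move=> s2 mp pp; rewrite /pint /Rintegral.
have /measurable_EFinP mE := mp.
by have := period_shift s2 mE (fun x => congr1 EFin (pp x)) => /= ->.
Qed.

Lemma pint_reflect p : measurable_fun setT (p : T -> R) ->
  pint (fun x => p (- x)) = pint p.
Proof.
move=> mp; rewrite /pint /Rintegral.
have /measurable_EFinP mE := mp.
by have := period_reflect mE => /= ->.
Qed.

Lemma cmeasurable_shift (s : R) f : cmeasurable f -> cmeasurable (fun x => f (x - s)).
Proof. by move=> [a b]; split; [exact: (measurable_fun_comp_subr s a)|exact: (measurable_fun_comp_subr s b)]. Qed.

Lemma cmeasurable_reflect f : cmeasurable f -> cmeasurable (fun x => f (- x)).
Proof. by move=> [a b]; split; [exact: (measurable_fun_comp_oppr a)|exact: (measurable_fun_comp_oppr b)]. Qed.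

Lemma csqint_shift (s : R) f : 0 <= s <= 2 * pi -> periodic2pi f -> csqint f ->
  csqint (fun x => f (x - s)).
Proof.
move=> s2 pf [mf fi]; split; first exact: cmeasurable_shift.
have pf' (x : R) : (Normc.normc (f (x + 2 * pi)) ^+ 2)%:E = (Normc.normc (f x) ^+ 2)%:E.
  by rewrite pf.
by have := period_shift s2 (measurable_normc_sqE mf) pf' => /= ->.
Qed.

Lemma csqint_reflect f : csqint f -> csqint (fun x => f (- x)).
Proof.
move=> [mf fi]; split; first exact: cmeasurable_reflect.
by have := period_reflect (measurable_normc_sqE mf) => /= ->.
Qed.

Lemma cint_shift (s : R) f : 0 <= s <= 2 * pi -> periodic2pi f -> cmeasurable f ->
  cint (fun x => f (x - s)) = cint f.
Proof.
move=> s2 pf [a b]; rewrite /cint; congr (_ +i* _).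
  by apply: (pint_shift s2 a) => x; rewrite pf.
by apply: (pint_shift s2 b) => x; rewrite pf.
Qed.

Lemma cint_reflect f : cmeasurable f -> cint (fun x => f (- x)) = cint f.
Proof.
by move=> [a b]; rewrite /cint; congr (_ +i* _); [exact: (pint_reflect a)|exact: (pint_reflect b)].
Qed.

End csqint.

(** * Fourier coefficients and the Bessel inequality *)

Arguments fourier {R} f k : simpl never.
Arguments Normc.normc {R} x : simpl never.

Section fourier_theory.
Context (R : realType).
Local Notation T := (lebesgueType R).
Local Notation C := R[i].
Implicit Types (f g h p q : R -> C) (a z : C) (j k : int).

Let twopi_gt0 : 0 < 2 * pi :> R.
Proof. by rewrite mulr_gt0// pi_gt0. Qed.

Lemma fourierE f k : fourier f k =
  ((2 * pi)^-1)%:C * cint (fun t => f t * cis (- k%:~R * t)).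
Proof.
rewrite /fourier /cint /pint; congr (_ * _).
by congr (_ +i* _); apply: eq_Rintegral => x _; rewrite mulNr.
Qed.

Lemma fourierD f g k : csqint f -> csqint g ->
  fourier (fun x => f x + g x) k = fourier f k + fourier g k.
Proof.
move=> If Ig; rewrite !fourierE -mulrDr -cintD.
- by congr (_ * cint _); apply/funext => x; rewrite mulrDl.
- exact: csqint_integrable (csqintM_cis _ If).
- exact: csqint_integrable (csqintM_cis _ Ig).
Qed.

Lemma fourierZ z f k : csqint f ->
  fourier (fun x => z * f x) k = z * fourier f k.
Proof.
move=> If; rewrite !fourierE [RHS]mulrCA.
rewrite -(cintZ z (csqint_integrable (csqintM_cis (- k%:~R) If))).
by congr (_ * cint _); apply/funext => x; rewrite mulrA.
Qed.

Lemma fourierB f g k : csqint f -> csqint g ->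
  fourier (fun x => f x - g x) k = fourier f k - fourier g k.
Proof.
move=> If Ig; rewrite (fourierD k If (csqintN Ig)); congr (_ + _).
rewrite -mulN1r -(fourierZ (-1) k Ig).
have -> : (fun x => - g x) = (fun x => -1 * g x) by apply/funext => x; rewrite mulN1r.
by [].
Qed.

Lemma fourier_sum (I : Type) (r : seq I) (F : I -> R -> C) k :
  (forall i, csqint (F i)) ->
  csqint (fun x => \sum_(i <- r) F i x) /\
  fourier (fun x => \sum_(i <- r) F i x) k = \sum_(i <- r) fourier (F i) k.
Proof.
move=> IF; elim: r => [|i r [IHi IHf]].
  have I0 : csqint (fun x : R => \sum_(i <- [::]) F i x).
    by under eq_fun do rewrite big_nil; exact: csqint_cst.
  split; first exact: I0.
  rewrite big_nil -[RHS](mul0r (fourier (fun x => \sum_(i <- [::]) F i x) k)) -(fourierZ 0 k I0).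
  suff -> : (fun x : R => \sum_(i <- [::]) F i x) =
    (fun x : R => 0 * \sum_(i <- [::]) F i x) by [].
  by apply/funext => x; rewrite big_nil mul0r.
have -> : (fun x : R => \sum_(i0 <- i :: r) F i0 x) = (fun x => F i x + \sum_(i0 <- r) F i0 x).
  by apply/funext => x; rewrite big_cons.
split; first exact: (csqintD (IF i) IHi).
by rewrite (fourierD k (IF i) IHi) IHf big_cons.
Qed.

(** For [k != 0], a translation by [pi / |k|] leaves the integral unchanged and multiplies the
    exponential by -1; the integral equals its opposite. *)
Lemma cint_cis k : cint (fun x : R => cis (k%:~R * x)) = if k == 0 then (2 * pi)%:C else 0.
Proof.
case: eqVneq => [->|k0].
  rewrite /cint /=; under eq_fun do rewrite mul0r cos0.
  rewrite pint_cst mul1r; congr (_ +i* _).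
  by under eq_fun do rewrite mul0r sin0; rewrite pint_cst mul0r.
set s : R := pi / `|k|%:~R.
have k0R : k%:~R != 0 :> R by rewrite intr_eq0.
have ak1 : 1 <= (`|k|%:~R : R).
  by rewrite ler1z -gtz0_ge1 normr_gt0.
have s2 : 0 <= s <= 2 * pi.
  have p0 := pi_gt0 R.
  rewrite divr_ge0 ?(ltW p0) ?(le_trans ler01)//=.
  rewrite ler_pdivrMr ?(lt_le_trans ltr01)//.
  by nra.
have [mk _] := csqint_cis (k%:~R : R).
have := cint_shift s2 (cis_periodic k) mk.
have -> : (fun x : R => cis (k%:~R * (x - s))) = (fun x => -1 * cis (k%:~R * x)).
  apply/funext => x; rewrite mulrBr cisD mulrC; congr (_ * _).
  have [->|->] : k%:~R * s = pi \/ k%:~R * s = - pi.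
  - rewrite /s; case: (ger0P k) => kk.
      by left; rewrite mulrC divfK.
    by right; rewrite mulrNz invrN mulrN mulrN mulrC divfK.
  - by rewrite /cis cosN sinN cospi sinpi oppr0; apply: eq_complexP; rewrite /= ?oppr0.
  - by rewrite opprK /cis cospi sinpi; apply: eq_complexP; rewrite /= ?oppr0.
rewrite (cintZ (-1) (csqint_integrable (csqint_cis _))).
rewrite mulN1r => /eqP; rewrite -subr_eq0 -opprD oppr_eq0 -mulr2n mulrn_eq0 /=.
by move=> /eqP.
Qed.

Lemma fourier_cis k j : fourier (fun x : R => cis (k%:~R * x)) j = (k == j)%:R.
Proof.
rewrite fourierE (_ : (fun _ => _) = (fun x => cis ((k - j)%:~R * x))).
  rewrite cint_cis subr_eq0; case: eqP => _; last by rewrite mulr0.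
  by rewrite -rmorphM mulVf// gt_eqF.
by apply/funext => x; rewrite -cisD -mulrDl intrB.
Qed.

Definition csqnorm f : R := pint (fun x => Normc.normc (f x) ^+ 2).

Lemma csqnorm_ge0 f : 0 <= csqnorm f.
Proof. by apply: Rintegral_ge0 => x _; exact: sqr_ge0. Qed.

Lemma csqnormE f : csqint f ->
  (csqnorm f)%:E = (\int[lebesgue]_(x in period_itv) ((Normc.normc (f x)) ^+ 2)%:E)%E.
Proof.
move=> [mf fi]; rewrite /csqnorm /pint /Rintegral fineK// ge0_fin_numE//.
by apply: integral_ge0 => x _; rewrite lee_fin sqr_ge0.
Qed.

Lemma norm2E f : norm2 f = Num.sqrt (csqnorm f).
Proof. by []. Qed.

(** As the exponential has modulus 1, expanding the square leaves only a cross term, whose integral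
    is [2 * pi] times the real part of [conjc a * fourier f k]. Completing the square in [a] gives
    this form, from which Bessel's inequality and the invariance of the gap both follow. *)
Lemma csqnorm_sub_cis f a k : csqint f ->
  csqnorm (fun x => f x - a * cis (k%:~R * x)) =
  csqnorm f + 2 * pi * (Normc.normc (a - fourier f k) ^+ 2 - Normc.normc (fourier f k) ^+ 2).
Proof.
move=> If.
pose g x := f x * cis (- k%:~R * x).
have Ig : cintegrable g := csqint_integrable (csqintM_cis _ If).
have Iag : pintegrable (fun x => complex.Re (conjc a * g x)).
  exact: cintegrable_Re (csqint_integrable (csqintZ (conjc a) (csqintM_cis (- k%:~R) If))).
have IN := pintegrable_normc_sq If.
rewrite [LHS](_ : _ = pint (fun x =>
    Normc.normc (f x) ^+ 2 - 2 * complex.Re (conjc a * g x) + Normc.normc a ^+ 2)); last first.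
  congr pint; apply/funext => x; rewrite /g mulNr /cis cosN sinN !normc_sq.
  have := cos2Dsin2 (k%:~R * x).
  move: (cos (k%:~R * x)) (sin (k%:~R * x)) => c s cs.
  case: (f x) => u v; case: a {Iag} => r t /=.
  (* The factor [c ^+ 2 + s ^+ 2], equal to 1, is kept visible so that the rest is a polynomial
     identity. *)
  transitivity (u ^+ 2 + v ^+ 2 -
    2 * (r * (u * c - v * - s) - - t * (u * - s + v * c)) +
    (r ^+ 2 + t ^+ 2) * (c ^+ 2 + s ^+ 2)); first by ring.
  by rewrite cs mulr1.
have I2 := pintegrableZ 2 Iag.
rewrite (pintD (pintegrableB IN I2) (pintegrable_cst _)) (pintB IN I2).
rewrite (pintZ 2 Iag) pint_cst -addrA; congr (_ + _).
have -> : pint (fun x => complex.Re (conjc a * g x)) = 2 * pi * complex.Re (conjc a * fourier f k).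
  have -> : pint (fun x => complex.Re (conjc a * g x)) = complex.Re (cint (fun x => conjc a * g x)) by [].
  rewrite (cintZ _ Ig) fourierE -/g mulrCA; move: (conjc a * cint g) => [u v] /=.
  by rewrite mul0r subr0 mulrA mulfV ?mul1r// gt_eqF.
rewrite !normc_sq; case: (fourier f k) => u v; case: a {Iag I2} => r t /=.
by ring.
Qed.

Lemma fourier_sub_cis f a k j : csqint f ->
  fourier (fun x => f x - a * cis (k%:~R * x)) j = fourier f j - a * (k == j)%:R.
Proof.
move=> If; rewrite (fourierB j If (csqintZ a (csqint_cis _))).
by rewrite (fourierZ a j (csqint_cis _)) fourier_cis.
Qed.

Lemma csqint_sub_cis f a k : csqint f -> csqint (fun x => f x - a * cis (k%:~R * x)).
Proof. by move=> If; exact: (csqintB If (csqintZ a (csqint_cis _))). Qed.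

(** For duplicate-free [s] and square integrable [f], this is the squared distance from [f] to the
    span of the exponentials with frequencies in [s]. *)
Definition bessel_gap (s : seq int) f : R :=
  csqnorm f - 2 * pi * \sum_(k <- s) Normc.normc (fourier f k) ^+ 2.

(** The squared norm and the [k]-th term of the sum change by the same amount, and the other
    coefficients do not change. *)
Lemma bessel_gap_sub_cis s f a k : csqint f -> uniq s -> k \in s ->
  bessel_gap s (fun x => f x - a * cis (k%:~R * x)) = bessel_gap s f.
Proof.
move=> If us ks; rewrite /bessel_gap (csqnorm_sub_cis a k If) !(bigD1_seq k ks us) /=.
rewrite (fourier_sub_cis a k k If) eqxx mulr1.
have -> : \sum_(i <- s | i != k) Normc.normc (fourier (fun x => f x - a * cis (k%:~R * x)) i) ^+ 2 =
    \sum_(i <- s | i != k) Normc.normc (fourier f i) ^+ 2.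
  apply: eq_bigr => i ik; rewrite (fourier_sub_cis a k i If) eq_sym (negbTE ik).
  by rewrite mulr0 subr0.
have -> : Normc.normc (fourier f k - a) = Normc.normc (a - fourier f k).
  by rewrite -[RHS]normcN opprB.
by ring.
Qed.

Lemma bessel s f : uniq s -> csqint f ->
  2 * pi * \sum_(k <- s) Normc.normc (fourier f k) ^+ 2 <= csqnorm f.
Proof.
move=> + If; rewrite -subr_ge0 -/(bessel_gap s f).
elim: s f If => [|k s IH] f If; first by rewrite /bessel_gap big_nil mulr0 subr0 csqnorm_ge0.
move=> /= /andP[ks us].
(* Removing the [k]-th Fourier component lowers the squared norm by exactly its term and leaves the
   coefficients in [s] alone; hence the induction over all [f]. *)
have := IH _ (csqint_sub_cis (fourier f k) k If) us.
rewrite /bessel_gap (csqnorm_sub_cis _ k If) subrr big_cons.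
rewrite (_ : \sum_(i <- s) _ = \sum_(i <- s) Normc.normc (fourier f i) ^+ 2).
  by rewrite Normc.normc0; congr (0 <= _); ring.
apply: eq_big_seq => i si; rewrite (fourier_sub_cis _ k i If).
have /negbTE -> : k != i by apply: contraNneq ks => ->.
by rewrite mulr0 subr0.
Qed.

Inductive trig : (R -> C) -> Prop :=
| trig0 : trig (fun=> 0)
| trigS p a k : trig p -> trig (fun x => a * cis (k%:~R * x) + p x).

Lemma trig_csqint p : trig p -> csqint p.
Proof.
elim=> [|{}p a k _ Ip]; first exact: csqint_cst.
exact: (csqintD (csqintZ a (csqint_cis _)) Ip).
Qed.

Lemma eq_trig p q : p =1 q -> trig p -> trig q.
Proof. by move=> /funext ->. Qed.

Lemma trigD p q : trig p -> trig q -> trig (fun x => p x + q x).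
Proof.
move=> tp tq; elim: tp => [|{}p a k _ IH]; first by apply: eq_trig tq => x; rewrite add0r.
by apply: eq_trig (trigS a k IH) => x; rewrite addrA.
Qed.

Lemma trig_monomial_mul a k p : trig p -> trig (fun x => a * cis (k%:~R * x) * p x).
Proof.
elim=> [|{}p b j _ IH]; first by apply: eq_trig trig0 => x; rewrite mulr0.
apply: eq_trig (trigS (a * b) (k + j) IH) => x.
by rewrite mulrDr intrD mulrDl cisD mulrACA.
Qed.

Lemma trigM p q : trig p -> trig q -> trig (fun x => p x * q x).
Proof.
move=> tp tq; elim: tp => [|{}p a k _ IH]; first by apply: eq_trig trig0 => x; rewrite mul0r.
by apply: eq_trig (trigD (trig_monomial_mul a k tq) IH) => x; rewrite mulrDl.
Qed.

Lemma trig_monomial a k : trig (fun x => a * cis (k%:~R * x)).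
Proof. by apply: eq_trig (trigS a k trig0) => x; rewrite addr0. Qed.

Lemma trig_cst a : trig (fun=> a).
Proof. by apply: eq_trig (trig_monomial a 0) => x; rewrite mul0r cis0 mulr1. Qed.

Lemma trigZ a p : trig p -> trig (fun x => a * p x).
Proof. by move=> tp; exact: (trigM (trig_cst a) tp). Qed.

(** The list [s0] collects the frequencies of [p]: an element of the span does not alter the
    distance to it. *)
Lemma bessel_gap_sub_trig p : trig p -> exists s0 : seq int, forall s f, uniq s ->
  {subset s0 <= s} -> csqint f -> bessel_gap s (fun x => f x - p x) = bessel_gap s f.
Proof.
elim=> [|{}p a k tp [s0 IH]].
  exists [::] => s f _ _ _; congr bessel_gap.
  by apply/funext => x; rewrite subr0.
exists (k :: s0) => s f us sub If.
rewrite -(bessel_gap_sub_cis a (k := k) If us); last by apply: sub; rewrite mem_head.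
rewrite -(IH s (fun x => f x - a * cis (k%:~R * x)) us).
- by congr bessel_gap; apply/funext => x; rewrite opprD addrA.
- by move=> i si; apply: sub; rewrite inE si orbT.
- exact: csqint_sub_cis.
Qed.

Definition trig_approx f := forall e : R, 0 < e ->
  exists2 p, trig p & (sqdist f p < e%:E)%E.

(** The gap of [f] equals the gap of [f - p], which is at most the squared norm of [f - p], hence
    below [e]. *)
Lemma parseval_trig_approx f (e : R) : csqint f -> trig_approx f -> 0 < e ->
  exists s0 : seq int, forall s, uniq s -> {subset s0 <= s} ->
  csqnorm f <= 2 * pi * \sum_(k <- s) Normc.normc (fourier f k) ^+ 2 + e.
Proof.
move=> If fa e0; have [p tp fp] := fa _ e0.
have [s0 H] := bessel_gap_sub_trig tp; exists s0 => s us ss0.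
have := H s f us ss0 If; rewrite /bessel_gap => E.
rewrite -lerBlDl -E lerBlDr; apply: (@le_trans _ _ e).
  rewrite -lee_fin (csqnormE (csqintB If (trig_csqint tp))).
  exact: ltW fp.
rewrite lerDl mulr_ge0//; first exact: ltW.
by apply: sumr_ge0 => k _; exact: sqr_ge0.
Qed.

End fourier_theory.

(** * Density of trigonometric polynomials *)

Section density.
Context (R : realType).
Local Notation T := (lebesgueType R).
Local Notation C := R[i].
Implicit Types (f g h p q : R -> C) (a z : C).

Definition csqinte f : \bar R :=
  (\int[lebesgue]_(x in period_itv) ((Normc.normc (f x)) ^+ 2)%:E)%E.

(** Working with squared norms, the bound [2 * |z|^2 + 2 * |w|^2] replaces the triangle inequality;
    this is where the quarters of [e] come from. *)
Lemma csqinte_le2 u v w (e : R) : cmeasurable u -> cmeasurable v -> cmeasurable w ->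
  (forall x, Normc.normc (u x) ^+ 2 <= 2 * Normc.normc (v x) ^+ 2 + 2 * Normc.normc (w x) ^+ 2) ->
  (csqinte v < (e / 4)%:E -> csqinte w < (e / 4)%:E -> csqinte u < e%:E)%E.
Proof.
move=> mu mv mw uvw ve we.
have mE h : cmeasurable h ->
    measurable_fun period_itv ((fun x => (Normc.normc (h x) ^+ 2)%:E) : T -> \bar R).
  by move=> mh; apply: measurable_funTS; exact: measurable_normc_sqE.
have n0 h (x : T) : (0 <= (Normc.normc (h x) ^+ 2)%:E)%E by rewrite lee_fin sqr_ge0.
have m2 h : cmeasurable h ->
    measurable_fun period_itv ((fun x => 2%:E * (Normc.normc (h x) ^+ 2)%:E)%E : T -> \bar R).
  by move=> mh; apply: emeasurable_funM; [exact: measurable_cst|exact: mE].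
have n2 h (x : T) : (0 <= 2%:E * (Normc.normc (h x) ^+ 2)%:E)%E by rewrite mule_ge0.
have mP := @measurable_period_itv R.
have lem : (csqinte u <= 2%:E * csqinte v + 2%:E * csqinte w)%E.
  rewrite /csqinte -(ge0_integralZl _ mP (mE v mv))//.
  rewrite -(ge0_integralZl _ mP (mE w mw))//.
  rewrite -(ge0_integralD _ mP _ (m2 v mv) _ (m2 w mw))//.
  apply: (ge0_le_integral _ mP); [by []|exact: mE| |].
    by apply: emeasurable_funD; [exact: m2|exact: m2].
  by move=> x _; rewrite -!EFinM -EFinD lee_fin.
apply: (le_lt_trans lem).
have -> : e%:E = (2%:E * (e / 4)%:E + 2%:E * (e / 4)%:E)%E.
  by rewrite -!EFinM -EFinD; congr EFin; field.
by apply: lteD; rewrite lte_pmul2l.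
Qed.

Lemma normc_sqr_real (x : R) : Normc.normc (x%:C) ^+ 2 = x ^+ 2.
Proof. by rewrite normc_sq /= expr0n addr0. Qed.

Lemma trig_cmeasurable p : trig p -> cmeasurable p.
Proof. by move=> tp; exact: csqint_measurable (trig_csqint tp). Qed.

Lemma trig_approx_lim f : cmeasurable f ->
  (forall e : R, 0 < e -> exists g, [/\ cmeasurable g, trig_approx g &
     (csqinte (fun x => f x - g x)%R < e%:E)%E]) -> trig_approx f.
Proof.
move=> mf H e e0; have e4 : 0 < e / 4 by rewrite divr_gt0.
have [g [mg tg fg]] := H _ e4; have [p tp gp] := tg _ e4.
exists p => //; have mp := trig_cmeasurable tp.
apply: (csqinte_le2 (cmeasurableB mf mp) (cmeasurableB mf mg) (cmeasurableB mg mp) _ fg gp).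
move=> x; rewrite (_ : f x - p x = (f x - g x) + (g x - p x)) ?normc_sqD//.
by rewrite addrA subrK.
Qed.

Lemma trig_approx_trig p : trig p -> trig_approx p.
Proof.
move=> tp e e0; exists p => //; rewrite /sqdist integral0_eq ?lte_fin//.
by move=> x _; rewrite subrr Normc.normc0 expr0n.
Qed.

Lemma trig_approxD f g : cmeasurable f -> cmeasurable g -> trig_approx f -> trig_approx g ->
  trig_approx (fun x => f x + g x).
Proof.
move=> mf mg tf tg e e0; have e4 : 0 < e / 4 by rewrite divr_gt0.
have [p tp fp] := tf _ e4; have [q tq gq] := tg _ e4.
have mp := trig_cmeasurable tp; have mq := trig_cmeasurable tq.
exists (fun x => p x + q x); first exact: trigD.
apply: (csqinte_le2 (cmeasurableB (cmeasurableD mf mg) (cmeasurableD mp mq))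
  (cmeasurableB mf mp) (cmeasurableB mg mq) _ fp gq).
by move=> x; rewrite opprD addrACA normc_sqD.
Qed.

Lemma trig_approxZ z f : cmeasurable f -> trig_approx f -> trig_approx (fun x => z * f x).
Proof.
move=> mf tf e e0; set c := Normc.normc z ^+ 2.
have c0 : 0 <= c by exact: sqr_ge0.
have c1 : 0 < c + 1 by rewrite ltr_wpDl.
(* The divisor is [c + 1] because [c] vanishes with [z]. *)
have [p tp fp] := tf (e / (c + 1)) (divr_gt0 e0 c1).
exists (fun x => z * p x); first exact: trigZ.
have mfp := measurable_normc_sqE (cmeasurableB mf (trig_cmeasurable tp)).
rewrite /sqdist (_ : (\int[lebesgue]_(x in period_itv) _)%E = (c%:E * sqdist f p)%E).
  apply: (@le_lt_trans _ _ ((c + 1)%:E * sqdist f p)%E).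
    apply: lee_wpmul2r; last by rewrite lee_fin lerDl.
    by apply: integral_ge0 => x _; rewrite lee_fin sqr_ge0.
  by rewrite muleC -lte_pdivlMr// -EFinM.
rewrite /sqdist -(ge0_integralZl _ (@measurable_period_itv R) (measurable_funTS mfp))//.
  by apply: eq_integral => x _; rewrite -mulrBr normc_sqM EFinM.
by move=> x _; rewrite lee_fin sqr_ge0.
Qed.

Lemma trig_approx_ae f g (N : set R) : cmeasurable f -> cmeasurable g ->
  (@completed_lebesgue_measure R).-negligible N ->
  (forall x, period_itv x -> ~ N x -> f x = g x) -> trig_approx f -> trig_approx g.
Proof.
move=> mf mg N0 fg tf e e0; have [p tp fp] := tf _ e0; exists p => //.
have mp := trig_cmeasurable tp.
rewrite /sqdist (_ : (\int[lebesgue]_(x in period_itv) _)%E = sqdist f p)//.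
apply: ae_eq_integral.
- exact: measurable_period_itv.
- exact: measurable_funTS (measurable_normc_sqE (cmeasurableB mg mp)).
- exact: measurable_funTS (measurable_normc_sqE (cmeasurableB mf mp)).
- apply: negligibleS N0 => x /= H; apply: contrapT => nx; apply: H => Px.
  by rewrite (fg x Px nx).
Qed.

(** Dominated convergence for the squared errors. It serves each later passage to the limit: from
    polynomials to rays, from finite to countable unions, from simple to nonnegative functions. *)
Lemma trig_approx_dct (f_ : nat -> R -> C) f (G : R -> R) (N : set R) :
  (forall n, cmeasurable (f_ n)) -> (forall n, trig_approx (f_ n)) -> cmeasurable f ->
  pintegrable G ->
  (@completed_lebesgue_measure R).-negligible N ->
  (forall x, period_itv x -> ~ N x ->
     (Normc.normc (f x - f_ n x) ^+ 2 : R) @[n --> \oo] --> (0 : R)) ->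
  (forall n x, Normc.normc (f x - f_ n x) ^+ 2 <= G x) -> trig_approx f.
Proof.
move=> mf_ tf_ mf [iG] N0 fN fG; apply: trig_approx_lim => // e e0.
pose h n (x : T) := (Normc.normc (f x - f_ n x) ^+ 2)%:E.
have mh n : measurable_fun period_itv (h n).
  exact: measurable_funTS (measurable_normc_sqE (cmeasurableB mf (mf_ n))).
have mc : measurable_fun period_itv (cst 0 : T -> \bar R) by exact: measurable_cst.
have := dominated_convergence (@measurable_period_itv R) mh mc _ iG _.
case.
- apply: negligibleS N0 => x /= H; apply: contrapT => nx; apply: H => Px.
  by apply: cvg_EFin; [exact: nearW|exact: fN].
- by apply: aeW => x n _; rewrite /h /= lee_fin ger0_norm ?sqr_ge0.
move=> _ _; rewrite integral0 => /fine_cvgP[fin cv].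
have cve := cvgr_lt (0 : R) cv _ e0.
have [n [nf ne]] : exists n, (\int[lebesgue]_(x in period_itv) h n x)%E \is a fin_num /\
    fine (\int[lebesgue]_(x in period_itv) h n x)%E < e.
  have /filter_ex[n [a b]] : \forall n \near \oo,
     (\int[lebesgue]_(x in period_itv) h n x)%E \is a fin_num /\
     fine (\int[lebesgue]_(x in period_itv) h n x)%E < e.
    by apply: filterS2 fin (cve _) => n; split.
  by exists n.
exists (f_ n); split => //; rewrite /csqinte -[ltLHS](fineK nf).
by rewrite lte_fin.
Qed.

(** The Newton-Schulz iteration for the sign. Its fixed points are -1, 0 and 1, and being a
    polynomial it maps trigonometric polynomials to trigonometric polynomials. *)
Definition sign_step (y : R) : R := (3 * y - y ^+ 3) / 2.

Lemma sign_stepN y : sign_step (- y) = - sign_step y.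
Proof. by rewrite /sign_step; field. Qed.

Lemma iter_sign_stepN n y : iter n sign_step (- y) = - iter n sign_step y.
Proof. by elim: n => //= n ->; rewrite sign_stepN. Qed.

(** One step multiplies the distance [1 - t] by [(1 - t) * (2 + t) / 2], which is at most
    [1 - t / 2]. Iterates never drop below the starting value [y], so the ratio [1 - y / 2] is
    uniform in [n]. *)
Lemma iter_sign_step_pos n y : 0 < y <= 1 ->
  y <= iter n sign_step y <= 1 /\ 1 - iter n sign_step y <= (1 - y / 2) ^+ n.
Proof.
move=> /andP[y0 y1]; elim: n => [|n [/andP[IH1 IH2] IH3]] /=.
  by rewrite lexx y1 expr0 lerBlDr lerDl ltW.
move: (iter n sign_step y) IH1 IH2 IH3 => t yt t1 IH.
have st : 1 - sign_step t = (1 - t) * ((1 - t) * (2 + t) / 2) by rewrite /sign_step; field.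
have f1 : 0 <= (1 - t) * (2 + t) / 2 by nra.
have f2 : (1 - t) * (2 + t) / 2 <= 1 - y / 2 by nra.
split; last first.
  rewrite st exprSr; apply: ler_pM => //; lra.
have -> : (sign_step t <= 1) = true by rewrite -subr_ge0 st mulr_ge0// subr_ge0.
rewrite andbT; apply: (le_trans yt); rewrite /sign_step.
nra.
Qed.

Lemma iter_sign_step0 n : iter n sign_step 0 = 0.
Proof. by elim: n => //= n ->; rewrite /sign_step expr0n /= mulr0 subr0 mul0r. Qed.

Lemma iter_sign_step_norm n y : `|y| <= 1 -> `|iter n sign_step y| <= 1.
Proof.
move=> y1; have [y0|y0|<-] := ltgtP 0 y; last by rewrite iter_sign_step0 normr0.
  have y01 : 0 < y <= 1 by rewrite y0 -(gtr0_norm y0).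
  have [/andP[a b] _] := iter_sign_step_pos n y01.
  by rewrite ger0_norm// (le_trans (ltW y0)).
have y01 : 0 < - y <= 1 by rewrite oppr_gt0 y0 -(ltr0_norm y0).
have [/andP[a b] _] := iter_sign_step_pos n y01.
rewrite -normrN -iter_sign_stepN ger0_norm//.
by rewrite (le_trans _ a)// oppr_ge0 ltW.
Qed.

Lemma iter_sign_step_cvg_pos y : 0 < y <= 1 -> (iter n sign_step y) @[n --> \oo] --> (1 : R).
Proof.
move=> y01; have /andP[y0 y1] := y01.
apply: (@squeeze_cvgr _ _ _ _ (fun n => 1 - (1 - y / 2) ^+ n) (cst 1)).
- apply: nearW => n; have [/andP[a b] c] := iter_sign_step_pos n y01.
  by rewrite b andbT lerBlDr -lerBlDl.
- rewrite -[X in _ --> X]subr0; apply: cvgB; first exact: cvg_cst.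
  by apply: cvg_expr; rewrite ger0_norm; lra.
- exact: cvg_cst.
Qed.

Lemma iter_sign_step_cvg y : `|y| <= 1 ->
  (iter n sign_step y) @[n --> \oo] --> (Num.sg y : R).
Proof.
move=> y1; have [y0|y0|<-] := ltgtP 0 y.
- by rewrite gtr0_sg//; apply: iter_sign_step_cvg_pos; rewrite y0 -(gtr0_norm y0).
- rewrite ltr0_sg//.
  have -> : (fun n => iter n sign_step y) = (fun n => - iter n sign_step (- y)).
    by apply/funext => n; rewrite iter_sign_stepN opprK.
  by apply: cvgN; apply: iter_sign_step_cvg_pos; rewrite oppr_gt0 y0 -(ltr0_norm y0).
- rewrite sgr0 (_ : (fun n => iter n sign_step 0) = cst 0); first exact: cvg_cst.
  by apply/funext => n; exact: iter_sign_step0.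
Qed.

Lemma trig_iter_sign_step (g : R -> R) n : trig (fun x => (g x)%:C) ->
  trig (fun x => (iter n sign_step (g x))%:C).
Proof.
move=> tg; elim: n => //= n IH.
apply: eq_trig (trigD (trigZ (3 / 2)%:C IH) (trigZ (- 1 / 2)%:C (trigM IH (trigM IH IH)))) => x.
by rewrite -!rmorphM -rmorphD; congr (_%:C); rewrite /sign_step; field.
Qed.

Lemma trig_sin (c : R) : trig (fun x => (sin (x - c))%:C).
Proof.
have := trigD (trig_monomial ((0 +i* (- (1 / 2))) * cis (- c)) 1)
              (trig_monomial ((0 +i* (1 / 2)) * cis c) (-1)).
apply: eq_trig => x.
rewrite mulrNz mulr1z !mul1r mulN1r -mulrA -cisD -[X in _ + X]mulrA -cisD.
rewrite [- c + x]addrC -[c - x]opprB; apply: eq_complexP; rewrite /= ?cosN ?sinN.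
  by field.
by field.
Qed.

Lemma negligible_lebesgue_finite (N : set R) : finite_set N ->
  (@completed_lebesgue_measure R).-negligible N.
Proof.
move=> fN; apply: negligible_lebesgueE; exists N; split => //.
  by apply: countable_measurable; [move=> x; exact: measurable_set1|exact: finite_set_countable].
by apply: countable_lebesgue_measure0; exact: finite_set_countable.
Qed.

Lemma cmeasurable_indic (A : set T) : measurable A ->
  cmeasurable (fun x => (\1_A x)%:C : C).
Proof. by move=> mA; split; [exact: measurable_indic|exact: measurable_cst]. Qed.

(** The function [sin ((t - x0) / 2)] has the right sign but is not [2 * pi]-periodic. The factor
    [cos (t / 2)], positive inside the period, turns it into a trigonometric polynomial of degree
    1. *)
Lemma sg_half_sin (x0 t : R) : - pi <= x0 <= pi -> - pi < t < pi ->
  Num.sg ((sin (t - x0 / 2) - sin (x0 / 2)) / 2) = Num.sg (t - x0).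
Proof.
move=> /andP[x1 x2] /andP[t1 t2].
have -> : (sin (t - x0 / 2) - sin (x0 / 2)) / 2 = cos (t / 2) * sin ((t - x0) / 2).
  have -> : t - x0 / 2 = t / 2 + (t - x0) / 2 by field.
  have -> : sin (x0 / 2) = sin (t / 2 - (t - x0) / 2) by congr sin; field.
  by rewrite sinD sinB; field.
rewrite sgrM gtr0_sg ?mul1r; last by apply: cos_gt0_pihalf; rewrite ltr_pdivlMr// ltr_pdivrMr// mulNr !divfK//; apply/andP.
have [h|h|<-] := ltgtP x0 t; last by rewrite subrr mul0r sin0.
- rewrite !gtr0_sg ?subr_gt0//; apply: sin_gt0_pi.
  by rewrite divr_gt0 ?subr_gt0//= ltr_pdivrMr//; lra.
- rewrite !ltr0_sg ?subr_lt0// -oppr_gt0 -sinN; apply: sin_gt0_pi.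
  by rewrite -mulNr opprB divr_gt0 ?subr_gt0//= ltr_pdivrMr//; lra.
Qed.

Lemma trig_approx_ray (x0 : R) : trig_approx (fun x => (\1_(`]x0, +oo[%classic) x)%:C).
Proof.
have mI : cmeasurable (fun x : R => (\1_(`]x0, +oo[%classic) x)%:C).
  by apply: cmeasurable_indic; exact: measurable_lebesgue_itv.
have [x1|x1] := ltP x0 (- pi).
  apply: (trig_approx_ae (cmeasurable_cst _) mI (negligible_set0 _) _ (trig_approx_trig (trig_cst 1))).
  move=> x; rewrite /period_itv /= in_itv /= => /andP[px _] _.
  by rewrite indicE mem_set//= in_itv /= andbT (lt_le_trans x1).
have [x2|x2] := ltP pi x0.
  apply: (trig_approx_ae (cmeasurable_cst _) mI (negligible_set0 _) _ (trig_approx_trig (trig_cst 0))).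
  move=> x; rewrite /period_itv /= in_itv /= => /andP[_ px] _.
  by rewrite indicE memNset//= in_itv /= andbT => h; move: (lt_trans x2 (lt_le_trans h px)); rewrite ltxx.
(* The division by 2 puts the values in [[-1, 1]], where the iteration converges to the sign. *)
pose g (t : R) := (sin (t - x0 / 2) - sin (x0 / 2)) / 2.
have g1 t : `|g t| <= 1.
  rewrite /g; have := sin_max (t - x0 / 2); have := sin_max (x0 / 2).
  rewrite !ler_norml => /andP[? ?] /andP[? ?]; apply/andP; split; lra.
have tg : trig (fun x => (g x)%:C).
  apply: eq_trig (trigD (trigZ (1 / 2)%:C (trig_sin (x0 / 2))) (trig_cst (- sin (x0 / 2) / 2)%:C)) => x.
  by rewrite -rmorphM -rmorphD; congr (_%:C); rewrite /g; field.
pose f_ n x := ((1 + iter n sign_step (g x)) / 2)%:C.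
have tf n : trig (f_ n).
  apply: eq_trig (trigD (trigZ (1 / 2)%:C (trig_iter_sign_step n tg)) (trig_cst (1 / 2)%:C)) => x.
  by rewrite -rmorphM -rmorphD; congr (_%:C); field.
(* At the three excluded points [g] vanishes, so the approximants stay at [1 / 2] there. Elsewhere
   [(1 + sign) / 2] is the indicator. *)
apply: (@trig_approx_dct f_ _ (cst 1) [set - pi; x0; pi] _ _ mI (pintegrable_cst 1)).
- by move=> n; exact: (trig_cmeasurable (tf n)).
- by move=> n; exact: (trig_approx_trig (tf n)).
- by apply: negligible_lebesgue_finite; rewrite !finite_setU; do ?split; exact: finite_set1.
- move=> x Px Nx.
  have -> : (fun n => Normc.normc ((\1_(`]x0, +oo[%classic) x)%:C - f_ n x) ^+ 2) =
      (fun n => (\1_(`]x0, +oo[%classic) x - (1 + iter n sign_step (g x)) / 2) ^+ 2).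
    by apply/funext => n; rewrite -rmorphB normc_sqr_real.
  have -> : \1_(`]x0, +oo[%classic) x = (1 + Num.sg (g x)) / 2 :> R.
    move: Px; rewrite /period_itv /= in_itv /= => /andP[px xp].
    rewrite /g sg_half_sin ?x1 ?x2//; last first.
      rewrite !lt_neqAle px xp !andbT; apply/andP; split; apply/eqP => E; apply: Nx.
        by left; left.
      by right.
    rewrite indicE; have [h|h|E] := ltgtP x0 x.
    + rewrite mem_set ?gtr0_sg ?subr_gt0//=; first by field.
      by rewrite in_itv /= h.
    + rewrite memNset ?ltr0_sg ?subr_lt0//= ?subrr ?mul0r//.
      by rewrite in_itv /= andbT; apply/negP; rewrite -leNgt ltW.
    + by case: Nx; left; right.
  have cv := iter_sign_step_cvg (g1 x).
  have : ((1 + Num.sg (g x)) / 2 - (1 + iter n sign_step (g x)) / 2) ^+ 2 @[n --> \oo] -->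
      ((1 + Num.sg (g x)) / 2 - (1 + Num.sg (g x)) / 2) ^+ 2.
    rewrite !expr2; apply: cvgM; (apply: cvgB; [exact: cvg_cst|]);
    by apply: cvgM; [apply: cvgD; [exact: cvg_cst|exact: cv]|exact: cvg_cst].
  by rewrite subrr expr0n.
- move=> n x; rewrite -rmorphB normc_sqr_real.
  have := iter_sign_step_norm n (g1 x); rewrite ler_norml => /andP[a b].
  have : (\1_(`]x0, +oo[%classic) x : R) = 0 \/ (\1_(`]x0, +oo[%classic) x : R) = 1.
    by rewrite indicE; case: (_ \in _); [right|left].
  by move: (iter _ _ _) a b => s a b [->|->]; rewrite /cst /=; nra.
Qed.

Lemma trig_approx_setC (A : set T) : measurable A ->
  trig_approx (fun x => (\1_A x)%:C) -> trig_approx (fun x => (\1_(~` A) x)%:C).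
Proof.
move=> mA tA.
have tN := trig_approxZ (-1) (cmeasurable_indic mA) tA.
have := trig_approxD (cmeasurable_cst 1) (cmeasurableZ (-1) (cmeasurable_indic mA))
  (trig_approx_trig (trig_cst 1)) tN.
rewrite (_ : (fun x => 1 + _) = (fun x => (\1_(~` A) x)%:C))//.
apply/funext => x; rewrite !indicE in_setC.
by case: (x \in A); rewrite /= ?rmorph1 ?rmorph0 ?mulr1 ?mulr0 ?addr0 ?subrr.
Qed.

Lemma trig_approx_bigcup (F : nat -> set T) : (forall n, measurable (F n)) ->
  trivIset setT F -> (forall n, trig_approx (fun x => (\1_(F n) x)%:C)) ->
  trig_approx (fun x => (\1_(\bigcup_k F k) x)%:C).
Proof.
move=> mF tF aF.
(* Disjointness makes the indicators of these partial unions finite sums of indicators; they are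
   eventually constant at each point. *)
pose A n := \big[setU/set0]_(i < n) F i.
have mA n : measurable (A n) by exact: bigsetU_measurable.
have aA n : trig_approx (fun x => (\1_(A n) x)%:C).
  elim: n => [|n IH].
    rewrite (_ : (fun x => _) = (fun=> 0)); first exact: trig_approx_trig (trig_cst 0).
    by apply/funext => x; rewrite /A big_ord0 indic0.
  have := trig_approxD (cmeasurable_indic (mA n)) (cmeasurable_indic (mF n)) IH (aF n).
  rewrite (_ : (fun x => _ + _) = (fun x => (\1_(A n.+1) x)%:C))//.
  apply/funext => x; rewrite -rmorphD; congr (_%:C).
  rewrite /A big_ord_recr /= -/(A n) !indicE in_setU.
  have [xA|xA] := boolP (x \in A n); have [xF|xF] := boolP (x \in F n); rewrite ?addr0 ?add0r//.
  move: xA xF; rewrite !inE /A -bigcup_mkord => -[k /= kn Fk] Fn.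
  by have kE := tF k n I I (ex_intro _ x (conj Fk Fn)); move: kn; rewrite kE ltnn.
apply: (@trig_approx_dct (fun n x => (\1_(A n) x)%:C) _ (cst 1) set0 _ aA _ (pintegrable_cst 1) (negligible_set0 _)).
- by move=> n; exact: (cmeasurable_indic (mA n)).
- by apply: cmeasurable_indic; exact: bigcupT_measurable.
- move=> x _ _.
  apply: (@cvg_near_cst _ _ _ _ _ _).
  have [[k _ Fk]|nF] := pselect ((\bigcup_k F k) x).
    exists k.+1 => // n /= kn.
    rewrite !indicE !mem_set ?subrr ?Normc.normc0 ?expr0n//.
      by rewrite /A -bigcup_mkord; exists k.
    by exists k.
  apply: nearW => n; rewrite !indicE !memNset ?subrr ?Normc.normc0 ?expr0n//.
  by rewrite /A -bigcup_mkord => -[k _ Fk]; apply: nF; exists k.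
- move=> n x; rewrite -rmorphB normc_sqr_real !indicE /cst /=.
  by case: (_ \in _); case: (_ \in _); rewrite /= ?subrr ?subr0 ?sub0r ?sqrrN ?expr0n ?expr1n.
Qed.

Lemma trig_approx_borel (A : set (measurableTypeR R)) : measurable A ->
  trig_approx (fun x => (\1_A x)%:C).
Proof.
move=> mA.
apply: (@dynkin_induction _ (measurableTypeR R) (@RGenOInfty.G R)
   (fun A => trig_approx (fun x => (\1_A x)%:C))).
- exact: RGenOInfty.measurableE.
(* Open right rays form a pi-system generating the Borel sets, which is why rays were treated
   first. *)
- move=> _ _ [x ->] [y ->]; exists (Num.max x y).
  apply/seteqP; split => z /=; rewrite !in_itv /= ?andbT gt_max.
    by move=> [-> ->].
  by move=> /andP[].
- rewrite (_ : (fun x => _) = (fun=> 1)); first exact: trig_approx_trig (trig_cst 1).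
  by apply/funext => x; rewrite indicT.
- by move=> _ [x ->]; exact: trig_approx_ray.
- by move=> S mS; apply: trig_approx_setC; exact: sub_caratheodory.
- move=> F mF tF aF; apply: trig_approx_bigcup => // n; exact: sub_caratheodory.
- by rewrite -[<<s _ >>](RGenOInfty.measurableE R).
Qed.

Lemma trig_approx_indic (A : set T) : measurable A -> trig_approx (fun x => (\1_A x)%:C).
Proof.
move=> mA; have [X [N [mX nN AE]]] := lebesgue_measurable_decomposition mA.
have mX' : measurable (X : set T) by exact: sub_caratheodory.
apply: (trig_approx_ae (cmeasurable_indic mX') (cmeasurable_indic mA)
  (negligible_lebesgueE nN) _ (trig_approx_borel mX)).
move=> x _ Nx; congr (_%:C); rewrite !indicE AE; congr (_%:R).
by rewrite in_setU (memNset Nx) orbF.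
Qed.

Lemma trig_approx_sum (I : Type) (r : seq I) (F : I -> R -> C) :
  (forall i, cmeasurable (F i)) -> (forall i, trig_approx (F i)) ->
  cmeasurable (fun x => \sum_(i <- r) F i x) /\ trig_approx (fun x => \sum_(i <- r) F i x).
Proof.
move=> mF tF; elim: r => [|i r [IHm IHt]].
  rewrite (_ : (fun x => _) = (fun=> 0)).
    by split; [exact: cmeasurable_cst|exact: trig_approx_trig (trig_cst 0)].
  by apply/funext => x; rewrite big_nil.
rewrite (_ : (fun x => _) = (fun x => F i x + \sum_(j <- r) F j x)).
  split; first exact: cmeasurableD (mF i) IHm.
  exact: trig_approxD (mF i) IHm (tF i) IHt.
by apply/funext => x; rewrite big_cons.
Qed.

Import HBNNSimple.

Lemma trig_approx_nnsfun (f : {nnsfun T >-> R}) : trig_approx (fun x => (f x)%:C).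
Proof.
pose r : seq R := finmap.enum_fset (fset_set (range f)).
rewrite (_ : (fun x => _) = (fun x => \sum_(y <- r) y%:C * (\1_(f @^-1` [set y]) x)%:C)).
  have mf y : measurable (f @^-1` [set y] : set T) by exact: measurable_sfunP.
  exact: (trig_approx_sum r (fun y => cmeasurableZ y%:C (cmeasurable_indic (mf y)))
    (fun y => trig_approxZ y%:C (cmeasurable_indic (mf y)) (trig_approx_indic (mf y)))).2.
apply/funext => x; rewrite fimfunE fsbig_finite//= rmorph_sum.
by apply: eq_bigr => y _; rewrite rmorphM.
Qed.

Lemma trig_approx_real_ge0 (f : T -> R) : measurable_fun setT f -> (forall x, 0 <= f x) ->
  pintegrable (fun x => f x ^+ 2) -> trig_approx (fun x => (f x)%:C).
Proof.
move=> mf f0 If.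
have mfE : measurable_fun setT (EFin \o f) by apply/measurable_EFinP.
pose g := nnsfun_approx measurableT mfE.
have mg n : cmeasurable (fun x => (g n x)%:C).
  by split; [exact: measurable_funP|exact: measurable_cst].
have cv (x : T) : (g n x)%:E @[n --> \oo] --> (f x)%:E.
  by apply: (cvg_nnsfun_approx measurableT mfE) => // y _; rewrite lee_fin.
(* With [0 <= g n x], this bounds the squared error by [f x ^+ 2], the dominating function. *)
have gf n x : g n x <= f x.
  have nd : nondecreasing_seq (fun n => (g n x)%:E).
    by move=> a b ab; rewrite lee_fin; exact/lefP/nd_nnsfun_approx.
  rewrite -lee_fin -(cvg_lim (@ereal_hausdorff R) (cv x)).
  rewrite (cvg_lim (@ereal_hausdorff R) (ereal_nondecreasing_cvgn nd)).
  by apply: ereal_sup_ubound; exists n.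
apply: (@trig_approx_dct (fun n x => (g n x)%:C) _ _ set0 mg (fun n => trig_approx_nnsfun (g n)) _ If (negligible_set0 _)).
- by split; [exact: mf|exact: measurable_cst].
- move=> x _ _.
  rewrite (_ : (fun n => _) = (fun n => (f x - g n x) * (f x - g n x))); last first.
    by apply/funext => n; rewrite -rmorphB normc_sqr_real expr2.
  have /fine_cvgP[_ cv'] := cv x.
  have cvb : f x - g n x @[n --> \oo] --> f x - f x by apply: cvgB; [exact: cvg_cst|exact: cv'].
  rewrite -[X in _ --> X](mul0r 0) -(subrr (f x)).
  by apply: cvgM; exact: cvb.
- move=> n x; rewrite -rmorphB normc_sqr_real.
  have g0 : 0 <= g n x by [].
  by have := gf n x; rewrite -[_ <= f x]subr_ge0 => a; rewrite ler_sqr ?nnegrE// gerBl.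
Qed.

Lemma trig_approx_real (f : T -> R) : measurable_fun setT f ->
  pintegrable (fun x => f x ^+ 2) -> trig_approx (fun x => (f x)%:C).
Proof.
move=> mf If.
pose fp x : R := (`|f x| + f x) / 2; pose fn x : R := (`|f x| - f x) / 2.
have mnf : measurable_fun setT (fun x => `|f x|) by exact: measurableT_comp.
have mn : measurable_fun setT fp.
  by apply: measurable_funM; [exact: measurable_funD|exact: measurable_cst].
have mm : measurable_fun setT fn.
  by apply: measurable_funM; [exact: measurable_funB|exact: measurable_cst].
have fabs x := ler_norm (f x); have fabsN x := ler_norm (- f x).
have fp0 x : 0 <= fp x by have := fabsN x; rewrite /fp normrN; lra.
have fn0 x : 0 <= fn x by have := fabs x; rewrite /fn; lra.
have le2 (h : T -> R) : measurable_fun setT h -> (forall x, 0 <= h x <= `|f x|) ->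
    pintegrable (fun x => h x ^+ 2).
  move=> mh hf; apply: (pintegrable_le _ _ If); first exact: measurable_funX.
  move=> x; have /andP[h0 hx] := hf x.
  by rewrite ger0_norm ?sqr_ge0// -[f x ^+ 2]real_normK ?num_real// lerXn2r// nnegrE.
have tp : trig_approx (fun x => (fp x)%:C).
  apply: (trig_approx_real_ge0 mn fp0); apply: (le2 _ mn) => x.
  by rewrite fp0 /fp /=; have := fabs x; lra.
have tn : trig_approx (fun x => (fn x)%:C).
  apply: (trig_approx_real_ge0 mm fn0); apply: (le2 _ mm) => x.
  by rewrite fn0 /fn /=; have := fabsN x; rewrite normrN; lra.
have cm (h : T -> R) : measurable_fun setT h -> cmeasurable (fun x : T => (h x)%:C).
  by move=> mh; split; [exact: mh|exact: measurable_cst].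
have := trig_approxD (cm _ mn) (cmeasurableZ (-1) (cm _ mm)) tp (trig_approxZ (-1) (cm _ mm) tn).
rewrite (_ : (fun x => _ + _) = (fun x => (f x)%:C))//.
apply/funext => x; rewrite mulN1r -rmorphB; congr (_%:C).
by rewrite /fp /fn; field.
Qed.

Lemma csqint_trig_approx f : csqint f -> trig_approx f.
Proof.
move=> If; have [mf _] := If; have [mr mi] := mf; have IN := pintegrable_normc_sq If.
have tr : trig_approx (fun x => (complex.Re (f x))%:C).
  apply: trig_approx_real => //; apply: (pintegrable_le _ _ IN); first exact: measurable_funX.
  by move=> x; rewrite ger0_norm ?sqr_ge0// normc_sq lerDl sqr_ge0.
have ti : trig_approx (fun x => (complex.Im (f x))%:C).
  apply: trig_approx_real => //; apply: (pintegrable_le _ _ IN); first exact: measurable_funX.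
  by move=> x; rewrite ger0_norm ?sqr_ge0// normc_sq lerDr sqr_ge0.
have cr : cmeasurable (fun x => (complex.Re (f x))%:C) by split; [exact: mr|exact: measurable_cst].
have ci : cmeasurable (fun x => (complex.Im (f x))%:C) by split; [exact: mi|exact: measurable_cst].
have := trig_approxD cr (cmeasurableZ 'i%C ci) tr (trig_approxZ 'i%C ci ti).
rewrite (_ : (fun x => _ + _) = f)//.
by apply/funext => x; rewrite [RHS]complexE.
Qed.

Lemma parseval f (e : R) : csqint f -> 0 < e ->
  exists s0 : seq int, forall s, uniq s -> {subset s0 <= s} ->
  csqnorm f <= 2 * pi * \sum_(k <- s) Normc.normc (fourier f k) ^+ 2 + e.
Proof. by move=> If; exact: (parseval_trig_approx If (csqint_trig_approx If)). Qed.

End density.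

(** * Absolutely continuous functions *)

Section absolute_continuity.
Context (R : realType).
Implicit Types (F G : R -> R) (s t : seq (R * R)) (p q : R * R).

Definition total_length s : R := \sum_(p <- s) (p.2 - p.1).
Definition total_oscillation F s : R := \sum_(p <- s) `|F p.2 - F p.1|.
Definition nonoverlapping p q := (p.2 <= q.1) || (q.2 <= p.1).
Definition subintervals (a b : R) s :=
  all (fun p => [&& a <= p.1, p.1 <= p.2 & p.2 <= b]) s && pairwise nonoverlapping s.

(** Absolute continuity of a real function with families given as lists, so that refining a family
    amounts to concatenating partitions. *)
Definition ac (a b : R) F := forall e : R, 0 < e -> exists2 d : R, 0 < d &
  forall s, subintervals a b s -> total_length s < d -> total_oscillation F s < e.

Lemma abs_continuous_on_ac (a b : R) (f : R -> R[i]) (pr : R[i] -> R) :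
  (forall z w, `|pr z - pr w| <= Normc.normc (z - w)) ->
  abs_continuous_on a b f -> ac a b (fun x => pr (f x)).
Proof.
move=> prle acf e e0; have [d d0 H] := acf e e0; exists d => // s /andP[sab ps] sd.
pose x (i : 'I_(size s)) := (nth (0, 0) s i).1.
pose y (i : 'I_(size s)) := (nth (0, 0) s i).2.
apply: (@le_lt_trans _ _ (\sum_(i < size s) Normc.normc (f (y i) - f (x i)))).
  rewrite /total_oscillation (big_nth (0, 0)) big_mkord.
  by apply: ler_sum => i _; exact: prle.
apply: H.
- move=> i; move/(all_nthP (0, 0)) : sab => /(_ i (ltn_ord i)) /and3P[? ? ?].
  by split.
- move/(pairwiseP (0, 0)) : ps => P.
  move=> i j ij; have [h|h|h] := ltngtP i j.
  + by have /orP[] := P i j (ltn_ord i) (ltn_ord j) h; [left|right].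
  + by have /orP[] := P j i (ltn_ord j) (ltn_ord i) h; [right|left].
  + by move/eqP: ij; case; exact: val_inj.
- by move: sd; rewrite /total_length (big_nth (0, 0)) big_mkord.
Qed.

Lemma normc_Re_sub (z w : R[i]) : `|complex.Re z - complex.Re w| <= Normc.normc (z - w).
Proof.
case: z w => [a b] [c d] /=; rewrite -[`|_|]sqrtr_sqr ler_sqrt ?lerDl ?sqr_ge0//.
by rewrite addr_ge0// sqr_ge0.
Qed.

Lemma normc_Im_sub (z w : R[i]) : `|complex.Im z - complex.Im w| <= Normc.normc (z - w).
Proof.
case: z w => [a b] [c d] /=; rewrite -[`|_|]sqrtr_sqr ler_sqrt ?lerDr ?sqr_ge0//.
by rewrite addr_ge0// sqr_ge0.
Qed.

Lemma subintervals1 (a b x y : R) : a <= x -> x <= y -> y <= b -> subintervals a b [:: (x, y)].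
Proof. by move=> ax xy yb; rewrite /subintervals /= ax xy yb. Qed.

Lemma subintervalsW (a b c d : R) s : a <= c -> d <= b -> subintervals c d s -> subintervals a b s.
Proof.
move=> ac db /andP[/allP cs ps]; rewrite /subintervals ps andbT.
apply/allP => p /cs /and3P[h1 h2 h3].
by rewrite (le_trans ac h1) h2 (le_trans h3 db).
Qed.

Lemma acB (a b : R) F G : ac a b F -> ac a b G -> ac a b (fun x => F x - G x).
Proof.
move=> hF hG e e0; have e2 : 0 < e / 2 by rewrite divr_gt0.
have [d1 d10 H1] := hF _ e2; have [d2 d20 H2] := hG _ e2.
exists (Num.min d1 d2) => [|s sab]; first by rewrite lt_min d10.
rewrite lt_min => /andP[/(H1 _ sab) h1 /(H2 _ sab) h2].
apply: (@le_lt_trans _ _ (total_oscillation F s + total_oscillation G s)); last by lra.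
rewrite /total_oscillation -big_split; apply: ler_sum => p _ /=.
rewrite (_ : _ - _ = (F p.2 - F p.1) - (G p.2 - G p.1)); last by ring.
exact: ler_normB.
Qed.

Definition partition_pairs (x : R) (l : seq R) : seq (R * R) := zip (x :: l) l.

Lemma partition_pairsP F (l : seq R) x y : itv_partition x y l ->
  [/\ subintervals x y (partition_pairs x l),
      total_length (partition_pairs x l) = y - x &
      total_oscillation F (partition_pairs x l) = variation x y F l].
Proof.
move=> xyl; have xy := itv_partition_le xyl.
have -> : variation x y F l = total_oscillation F (partition_pairs x l).
  rewrite variation_zip//; clear; rewrite /total_oscillation /partition_pairs.
  elim: l x => [|z l IH] x; first by rewrite /= !big_nil.
  by rewrite /= !big_cons IH.
suff [] : subintervals x y (partition_pairs x l) /\ total_length (partition_pairs x l) = y - x by [].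
move: xyl => [/= pl /eqP ly]; elim: l x pl ly xy => [|z l IH] x /=.
  by move=> _ -> _; rewrite /total_length big_nil subrr.
move=> /andP[xz zl] lz xy.
have zy : z <= y.
  by have : itv_partition z y l by [split => //; apply/eqP]; exact: itv_partition_le.
have [zs zt] := IH z zl lz zy; split; last first.
  by rewrite /total_length /= big_cons /= -/(total_length _) zt addrC addrA subrK.
have /andP[za zp] := zs; rewrite /subintervals /= lexx (ltW xz) zy zp andbT /=.
apply/andP; split.
  by have /andP[] := subintervalsW (ltW xz) (lexx y) zs.
by rewrite andbT; apply/allP => p /(allP za)/and3P[h _ _]; rewrite /nonoverlapping /= h.
Qed.

Section bounded_variation_of_ac.
Variables (a b : R) (F : R -> R).
Hypotheses (ab : a <= b) (acF : ac a b F).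

(** The modulus [d] for [e = 1] bounds the variation by 1 on every interval shorter than [d];
    finitely many such intervals cover [[a, b]], and variation is additive. *)
Lemma ac_total_variation_fin_num : total_variation a b F \is a fin_num.
Proof.
have [d d0 H] := acF ltr01.
have small x y : a <= x -> x <= y -> y <= b -> y - x < d -> total_variation x y F \is a fin_num.
  move=> ax xy yb xyd; apply/bounded_variationP => //.
  exists 1 => _ [l xyl <-]; have [h1 h2 <-] := partition_pairsP F xyl.
  by apply/ltW/H; [exact: subintervalsW h1|rewrite h2].
have d2 : 0 < d / 2 by rewrite divr_gt0.
(* Steps have length [d / 2] because [small] asks for a length strictly below [d]. *)
have main n c : a <= c -> c <= b -> c - a <= n%:R * (d / 2) ->
    total_variation a c F \is a fin_num.
  elim: n c => [|n IH] c ac cb.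
    rewrite mul0r => ca; have -> : c = a by lra.
    by rewrite total_variationxx.
  rewrite -natr1 mulrDl mul1r => can.
  have [h|h] := leP (c - d / 2) a; first by apply: small => //; lra.
  rewrite (@total_variationD _ a c (c - d / 2)) ?fin_numD; [|lra..].
  by rewrite IH ?small//; lra.
apply: (main (Num.truncn ((b - a) / (d / 2))).+1) => //.
by rewrite -ler_pdivrMr// ltW// truncnS_gt.
Qed.

Lemma ac_total_variation_sub_fin_num x y : a <= x -> x <= y -> y <= b ->
  total_variation x y F \is a fin_num.
Proof.
move=> ax xy yb; have := ac_total_variation_fin_num.
rewrite (@total_variationD _ a b x) ?(le_trans xy)// (@total_variationD _ x b y)//.
by rewrite !fin_numD => /and3P[].
Qed.

Definition variation_fun (x : R) : R := fine (total_variation a x F).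

Lemma variation_funB x y : a <= x -> x <= y -> y <= b ->
  (variation_fun y - variation_fun x)%:E = total_variation x y F.
Proof.
move=> ax xy yb; rewrite /variation_fun (@total_variationD _ a y x)//.
have xyf := ac_total_variation_sub_fin_num ax xy yb.
have axf := ac_total_variation_sub_fin_num (lexx a) ax (le_trans xy yb).
by rewrite fineD// addrC addKr fineK.
Qed.

Lemma variation_fun_ge x y : a <= x -> x <= y -> y <= b ->
  `|F y - F x| <= variation_fun y - variation_fun x.
Proof.
by move=> ax xy yb; rewrite -lee_fin variation_funB//; exact: total_variation_ge.
Qed.

(** Each interval of [s] is replaced by a partition on which [F] attains the total variation up to
    the slack [n]. The last clause of the conclusion serves the induction: pieces coming from
    different intervals cannot overlap. *)
Lemma refine_subintervals (n : R) s : 0 < n -> subintervals a b s -> exists t,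
  [/\ subintervals a b t, total_length t = total_length s,
      total_oscillation variation_fun s <= total_oscillation F t + n * (size s)%:R &
      forall q, q \in t -> exists2 p, p \in s & p.1 <= q.1 /\ q.2 <= p.2].
Proof.
move=> n0; elim: s => [|[x y] s IH]; first by move=> _; exists [::]; split => //; rewrite /total_oscillation !big_nil mulr0 addr0.
rewrite {1}/subintervals /= => /andP[/andP[/and3P[ax xy yb] sa] /andP[xys sp]].
have [t [tab tl tv tin]] := IH (introT andP (conj sa sp)).
have Vxy : `|variation_fun y - variation_fun x| = variation_fun y - variation_fun x.
  by rewrite ger0_norm// (le_trans _ (variation_fun_ge ax xy yb)).
move: (xy); rewrite le_eqVlt => /predU1P[xyE|xlty].
  exists t; split => //.
  - by rewrite /total_length big_cons /= xyE subrr add0r.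
  - rewrite /total_oscillation big_cons /= xyE subrr normr0 add0r (le_trans tv)// lerD2l.
    by rewrite ler_pM2l// ler_nat.
  - by move=> q /tin[p ps h]; exists p => //; rewrite inE ps orbT.
have fxy := ac_total_variation_sub_fin_num ax xy yb.
have [_ [v [l xyl <-] <-] lv] := ub_ereal_sup_adherent n0 fxy.
have [lab ll lo] := partition_pairsP F xyl.
have /andP[la lp] := lab; have /andP[ta tp] := tab.
exists (partition_pairs x l ++ t); split.
- have /andP[la' _] := subintervalsW ax yb lab.
  rewrite /subintervals all_cat la' ta pairwise_cat lp tp !andbT /=.
  apply/allrelP => p q pl qt; have /and3P[p1 p2 p3] := allP la p pl.
  have [r rs [r1 r2]] := tin q qt.
  have /orP[/= h|/= h] := allP xys r rs.
    by apply/orP; left; rewrite (le_trans p3)// (le_trans h).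
  by apply/orP; right; rewrite (le_trans r2)// (le_trans h).
- rewrite /total_length big_cat big_cons /= -!/(total_length _) tl.
  by congr (_ + _); exact: ll.
- rewrite /total_oscillation big_cat big_cons /= -!/(total_oscillation _ _) lo Vxy.
  have : variation_fun y - variation_fun x <= variation x y F l + n.
    rewrite -lerBlDr; apply: ltW; rewrite -lte_fin; apply: le_lt_trans lv.
    by rewrite EFinB (variation_funB ax xy yb).
  rewrite -natr1 mulrDr mulr1 -!/(total_oscillation _ _).
  by move: tv; lra.
- move=> q; rewrite mem_cat => /orP[/(allP la)/and3P[h1 _ h3]|/tin[p ps h]].
    by exists (x, y) => //; rewrite mem_head.
  by exists p => //; rewrite inE ps orbT.
Qed.

(** Refinement preserves total length, so the modulus of [F] for [e / 2] works for its variation;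
    the slack [e / 2 / (size s).+1] per interval costs at most another [e / 2]. *)
Lemma ac_variation_fun : ac a b variation_fun.
Proof.
move=> e e0; have e2 : 0 < e / 2 by rewrite divr_gt0.
have [d d0 H] := acF e2; exists d => // s sab sd.
have n1 : 0 < (size s).+1%:R :> R by [].
have [t [tab tl tv _]] := refine_subintervals (divr_gt0 e2 n1) sab.
apply: (le_lt_trans tv); rewrite [X in _ < X]splitr.
have /H : total_length t < d by rewrite tl.
move=> /(_ tab) tF; apply: ltr_leD => //.
rewrite -mulrA ler_piMr ?(ltW e2)// mulrC ler_pdivrMr// mul1r ler_nat//.
Qed.

End bounded_variation_of_ac.

End absolute_continuity.

(** * Nondecreasing absolutely continuous functions as indefinite integrals *)

Section monotone_ac.
Context (R : realType).
Variables (a b : R) (G : R -> R).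
Hypotheses (ab : a < b) (ndG : forall x y, a <= x -> x <= y -> y <= b -> G x <= G y)
  (acG : ac a b G).

(** The projection onto [[a, b]]. Composing [G] with it gives a function on the line, constant
    outside [[a, b]], that defines a Stieltjes measure. *)
Definition clamp (x : R) : R := Num.max a (Num.min x b).

Let clamp_itv x : a <= clamp x <= b.
Proof. by rewrite /clamp le_max lexx ge_max (ltW ab) ge_min lexx orbT. Qed.

Let clamp_le x y : x <= y -> clamp x <= clamp y.
Proof.
move=> xy; rewrite /clamp; case: (leP x b); case: (leP y b) => ? ?;
  rewrite ?ge_max ?le_max ?lexx ?xy ?orbT//= ?(ltW ab) ?orbT//; lra.
Qed.

Let clamp_lip x y : x <= y -> clamp y - clamp x <= y - x.
Proof.
move=> xy; rewrite /clamp.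
by case: (leP x b); case: (leP y b); case: (leP a x); case: (leP a y); case: (leP a b); lra.
Qed.

Let clamp_id x : a <= x -> x <= b -> clamp x = x.
Proof. by move=> ax xb; rewrite /clamp (min_idPl xb) (max_idPr ax). Qed.

Let Gc x := G (clamp x).

Let Gc_nd : nondecreasing Gc.
Proof.
move=> x y xy; rewrite /Gc; have /andP[h1 h2] := clamp_itv x; have /andP[h3 h4] := clamp_itv y.
by apply: ndG => //; exact: clamp_le.
Qed.

(** Clamping is nondecreasing and 1-Lipschitz: it sends nonoverlapping families to nonoverlapping
    families in [[a, b]] of no greater total length. *)
Let Gc_ac (e : R) : 0 < e -> exists2 d : R, 0 < d & forall s : seq (R * R),
  all (fun p => p.1 <= p.2) s -> pairwise (@nonoverlapping R) s -> total_length s < d ->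
  total_oscillation Gc s < e.
Proof.
move=> e0; have [d d0 H] := acG e0; exists d => // s sa sp sd.
pose s' := [seq (clamp p.1, clamp p.2) | p <- s].
have -> : total_oscillation Gc s = total_oscillation G s'.
  by rewrite /total_oscillation big_map.
apply: H.
- apply/andP; split.
    rewrite all_map; apply: sub_all sa => p /= p12.
    have /andP[-> _] := clamp_itv p.1; have /andP[_ ->] := clamp_itv p.2.
    by rewrite clamp_le.
  rewrite pairwise_map; apply: sub_pairwise sp => p q /orP[] h /=; apply/orP; [left|right];
    exact: clamp_le.
- apply: le_lt_trans sd; rewrite /total_length big_map big_seq [leRHS]big_seq.
  by apply: ler_sum => p ps; apply: clamp_lip; exact: (allP sa).
Qed.

Let Gc_cont : continuous (Gc : R -> R).
Proof.
move=> x; apply/cvgrPdist_lt => e e0; have [d d0 H] := Gc_ac e0.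
near=> y.
have yx : `|x - y| < d by near: y; apply/nbhs_ballP; exists d.
have [xy|xy] := leP x y.
  have := H [:: (x, y)]; rewrite /total_length /total_oscillation !big_seq1 /= xy distrC.
  by apply => //; rewrite (le_lt_trans _ yx)// distrC ler_norm.
have := H [:: (y, x)]; rewrite /total_length /total_oscillation !big_seq1 /= (ltW xy).
by apply => //; rewrite (le_lt_trans _ yx)// ler_norm.
Unshelve. all: by end_near. Qed.

Let Gc_rc : right_continuous (Gc : R -> R).
Proof. by move=> x; apply: cvg_within_filter; exact: Gc_cont. Qed.

Let Gcum : cumulative R R := HB.pack Gc (isCumulative.Build R _ R Gc Gc_nd Gc_rc).

Let nu : {measure set (measurableTypeR R) -> \bar R} := lebesgue_stieltjes_measure Gcum.

Let nu_itv (x y : R) : x <= y -> nu `]x, y]%classic = (Gc y - Gc x)%:E.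
Proof.
move=> xy; apply: etrans (measurable_mu_extE (wlength Gcum) (is_ocitv x y)) _.
exact: (@wlength_itv_bnd R Gc x y false false xy).
Qed.

Let bounded_open_itvE (J : set R) (c d : R) : open J -> is_interval J -> J !=set0 ->
  J `<=` `]c, d[ -> J = `]inf J, sup J[%classic /\ inf J < sup J.
Proof.
move=> oJ iJ [z Jz] Jcd.
have lJ : has_lbound J by exists c => x /Jcd; rewrite /= in_itv/= => /andP[/ltW].
have uJ : has_ubound J by exists d => x /Jcd; rewrite /= in_itv/= => /andP[_ /ltW].
have nl : ~ J (inf J).
  move=> Jl; have /nbhs_ballP[e /= e0 be] := oJ _ Jl.
  have : J (inf J - e / 2).
    by apply: be; rewrite /ball /= opprB addrCA subrr addr0 ger0_norm ?divr_ge0 ?ltW// ltr_pdivrMr//; lra.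
  by move/(ge_inf lJ); have : 0 < e := e0; lra.
have nr : ~ J (sup J).
  move=> Jl; have /nbhs_ballP[e /= e0 be] := oJ _ Jl.
  have : J (sup J + e / 2).
    by apply: be; rewrite /ball /= opprD addNKr normrN ger0_norm ?divr_ge0 ?ltW// ltr_pdivrMr//; lra.
  by move/(ub_le_sup uJ); have : 0 < e := e0; lra.
have E : J = `]inf J, sup J[%classic.
  by rewrite {1}((is_intervalP J).1 iJ) /Rhull (asboolT lJ) (asboolT uJ) (asboolF nl) (asboolF nr).
split=> //; move: (Jz); rewrite {1}E /= in_itv /= => /andP[h1 h2].
exact: lt_trans h1 h2.
Qed.

(** An open set is a countable disjoint union of open intervals. Each finite subfamily is a family
    to which the modulus of absolute continuity applies, and the bound survives the limit. The
    enclosing interval keeps the components bounded. *)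
Let nu_open_small (e : R) : 0 < e -> exists2 d : R, 0 < d & forall W : set R, open W ->
  W `<=` `]a - 1, b + 1[ -> (lebesgue_measure W < d%:E)%E -> (nu W <= e%:E)%E.
Proof.
move=> e0; have [d d0 H] := Gc_ac e0; exists d => // W oW Wab Wd.
pose J := open_disjoint_itv oW.
have mJ k : measurable (J k : set (measurableTypeR R)).
  by apply: open_measurable; exact: open_disjoint_itv_open.
have tJ : trivIset setT J by exact: open_disjoint_itv_trivIset.
have JW k : J k `<=` W by rewrite (open_disjoint_itv_bigcup oW) => x Jx; exists k.
have JE k : J k !=set0 -> J k = `]inf (J k), sup (J k)[%classic /\ inf (J k) < sup (J k).
  move=> J0; apply: (@bounded_open_itvE _ (a - 1) (b + 1)) => //.
  - exact: open_disjoint_itv_open.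
  - exact: open_disjoint_itv_is_interval.
  - exact: subset_trans (JW k) Wab.
have -> : nu W = (\sum_(0 <= k <oo) nu (J k))%E.
  by rewrite [in LHS](open_disjoint_itv_bigcup oW) measure_semi_bigcup//; apply: bigcupT_measurable.
apply: lime_le; first by apply: is_cvg_nneseries => n _ _; exact: measure_ge0.
apply: nearW => N.
(* Empty components are discarded, as their [inf] and [sup] would be default values. *)
pose K := [seq k <- index_iota 0 N | `[< J k !=set0 >]].
pose s := [seq (inf (J k), sup (J k)) | k <- K].
have sumK (m : {measure set (measurableTypeR R) -> \bar R}) :
    (\sum_(0 <= k < N) m (J k) = \sum_(k <- K) m (J k))%E.
  rewrite big_filter [RHS]big_mkcond; apply: eq_bigr => k _; case: asboolP => // J0.
  rewrite (_ : J k = set0) ?measure0//; apply/seteqP; split => // x Jx.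
  by exfalso; apply: J0; exists x.
have lenJ : (\sum_(k <- K) lebesgue_measure (J k) = (total_length s)%:E)%E.
  rewrite /total_length big_map -sumEFin big_seq [RHS]big_seq; apply: eq_bigr => k.
  rewrite mem_filter => /andP[/asboolP J0 _]; have [E lt] := JE _ J0.
  by rewrite {1}E lebesgue_measure_itv /= lte_fin lt -EFinB.
have sd : total_length s < d.
  rewrite -lte_fin -lenJ -sumK; apply: le_lt_trans Wd.
  rewrite big_mkord -measure_semi_additive//; last exact: bigsetU_measurable.
  - rewrite le_measure ?inE//.
    + exact: bigsetU_measurable.
    + exact: open_measurable.
    + by rewrite -bigcup_mkord => x [k _ /JW].
rewrite sumK; apply: (@le_trans _ _ (total_oscillation Gc s)%:E); last first.
  rewrite lee_fin ltW//; apply: H => //.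
    rewrite all_map; apply/allP => k; rewrite mem_filter => /andP[/asboolP J0 _] /=.
    by have [_ /ltW] := JE _ J0.
  rewrite pairwise_map.
  have : pairwise [rel x y | x != y] K by rewrite -uniq_pairwise filter_uniq// iota_uniq.
  apply: (@sub_in_pairwise _ (fun k => `[< J k !=set0 >])); last exact: filter_all.
  move=> j k /asboolP Jj /asboolP Jk /= jk; rewrite /nonoverlapping /=.
  have [Ej ltj] := JE _ Jj; have [Ek ltk] := JE _ Jk.
  apply: contraT; rewrite negb_or -!ltNge => /andP[h1 h2].
  move: jk => /eqP; case; apply: tJ => //.
  (* If two components overlapped, the midpoint of their common part would lie in both, against
     disjointness. *)
  exists ((Num.max (inf (J j)) (inf (J k)) + Num.min (sup (J j)) (sup (J k))) / 2).
  rewrite {1}Ej {1}Ek /= !in_itv /=.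
  case: (leP (inf (J j)) (inf (J k))); case: (leP (sup (J j)) (sup (J k))) => ? ?;
    split; apply/andP; split; lra.
rewrite /total_oscillation big_map -sumEFin big_seq [leRHS]big_seq; apply: lee_sum => k.
rewrite mem_filter => /andP[/asboolP J0 _]; have [EJ lt] := JE _ J0.
apply: (@le_trans _ _ (nu `]inf (J k), sup (J k)]%classic)).
  apply: le_measure; rewrite ?inE//.
  by rewrite {1}EJ; apply: subset_itvl; rewrite bnd_simp.
by rewrite (nu_itv (ltW lt)) lee_fin ler_norm.
Qed.

(** Outer regularity encloses the null set in an open set of small length, which is cut down to a
    neighbourhood of [[a, b]]. *)
Let nu_null (A : set (measurableTypeR R)) : measurable A -> A `<=` `]a, b] ->
  lebesgue_measure A = 0%E -> nu A = 0%E.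
Proof.
move=> mA Aab A0; apply/eqP; rewrite eq_le measure_ge0 andbT.
apply/lee_addgt0Pr => e e0; rewrite add0e.
have [d d0 H] := nu_open_small e0.
have [U [oU AU Ud]] : exists U : set R, [/\ open U, A `<=` U & (lebesgue_measure (U `\` A) < d%:E)%E].
  have A0' : (lebesgue_measure A < +oo)%E by rewrite A0.
  exact: lebesgue_regularity_outer mA A0' d0.
pose W := U `&` `]a - 1, b + 1[%classic.
have oW : open W by apply: openI => //; exact: itv_open.
have mW : measurable (W : set (measurableTypeR R)) by exact: open_measurable.
have mU : measurable (U : set (measurableTypeR R)) by exact: open_measurable.
have AW : A `<=` W.
  move=> x Ax; split; first exact: AU.
  by have := Aab _ Ax; rewrite /= !in_itv /= => /andP[h1 h2]; apply/andP; split; lra.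
apply: (@le_trans _ _ (nu W)); first by apply: le_measure; rewrite ?inE.
apply: (H W oW); first by move=> x [].
apply: le_lt_trans Ud.
apply: (@le_trans _ _ (lebesgue_measure ((U `\` A) `|` A))).
  apply: le_measure; rewrite ?inE//; first by apply: measurableU => //; exact: measurableD.
  by move=> x [Ux _]; have [Ax|nAx] := pselect (A x); [right|left].
apply: (le_trans (measureU2 _ _ _)) => //; first exact: measurableD.
by rewrite [X in (_ + X <= _)%E](_ : _ = 0%E) ?adde0.
Qed.

Lemma monotone_ac_density : exists g : R -> R,
  [/\ measurable_fun setT (g : measurableTypeR R -> R),
      (@lebesgue_measure R).-integrable setT (EFin \o g) &
      forall x, a <= x -> x <= b -> (G x - G a)%:E = (\int[lebesgue_measure]_(t in `[a, x]) (g t)%:E)%E].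
Proof.
have mD : measurable (`]a, b]%classic : set (measurableTypeR R)) by [].
have nuD : (nu `]a, b]%classic < +oo)%E by rewrite nu_itv ?ltW// ltry.
(* The restriction to []a, b]] is finite, and only subsets of []a, b]] have to be tested for
   absolute continuity. *)
pose nu' : {finite_measure set (measurableTypeR R) -> \bar R} := mfrestr mD nuD.
have dom : nu' `<< (@lebesgue_measure R).
  move=> B B0 A mA AB; rewrite /nu' /= /mfrestr /mrestr; apply: nu_null.
  - exact: measurableI.
  - by move=> x [].
  - by apply: B0; [exact: measurableI|move=> x [/AB]].
have [f [f0 ff fi fE]] := radon_nikodym_sigma_finite dom.
have ffE : EFin \o (fine \o f) = f by apply/funext => x /=; rewrite fineK.
exists (fine \o f); split.
- apply/measurable_EFinP; rewrite ffE; exact: measurable_int fi.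
- by rewrite ffE.
- move=> x ax xb; rewrite -integral_itv_obnd_cbnd; last first.
    rewrite -[X in measurable_fun _ X]/(EFin \o (fine \o f)) ffE.
    by apply: measurable_funTS; exact: measurable_int fi.
  have := fE `]a, x]%classic (measurable_itv _).
  rewrite /nu' /= /mfrestr /mrestr (_ : `]a, x] `&` `]a, b] = `]a, x]%classic); last first.
    apply/seteqP; split => [y []//|y /=]; rewrite !in_itv /= => /andP[h1 h2].
    by rewrite h1 h2 (le_trans h2 xb).
  rewrite nu_itv// /Gc !clamp_id// ?(ltW ab)// => ->.
  by apply: eq_integral => y _ /=; rewrite fineK.
Qed.

End monotone_ac.

(** * The fundamental theorem of calculus for absolutely continuous functions *)

Section ac_ftc.
Context (R : realType).
Implicit Types (F g : R -> R).

(** With [V] the variation of [F], both [V] and [V - F] are nondecreasing and absolutely continuous,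
    and [F] is their difference. *)
Lemma ac_density (a b : R) F : a < b -> ac a b F -> exists g,
  [/\ measurable_fun setT (g : measurableTypeR R -> R),
      (@lebesgue_measure R).-integrable setT (EFin \o g) &
      forall x, a <= x -> x <= b -> F x - F a = \int[lebesgue_measure]_(t in `[a, x]) g t].
Proof.
move=> ab acF; have leab := ltW ab.
pose V := variation_fun a F.
have Vge x y : a <= x -> x <= y -> y <= b -> `|F y - F x| <= V y - V x.
  by move=> ax xy yb; exact: (variation_fun_ge leab acF ax xy yb).
have acV : ac a b V := ac_variation_fun leab acF.
have [g1 [m1 i1 E1]] := monotone_ac_density ab
  (fun x y ax xy yb => etrans (esym (subr_ge0 _ _)) (le_trans (normr_ge0 _) (Vge x y ax xy yb))) acV.
have ndVF x y : a <= x -> x <= y -> y <= b -> V x - F x <= V y - F y.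
  by move=> ax xy yb; have := ler_norm (F y - F x); have := Vge x y ax xy yb; lra.
have [g2 [m2 i2 E2]] := monotone_ac_density ab ndVF (acB acV acF).
exists (fun x => g1 x - g2 x); split.
- exact: measurable_funB.
- have := integrableB measurableT i1 i2.
  by apply: eq_integrable => // x _ /=; rewrite EFinB.
- move=> x ax xb.
  have i1' : lebesgue_measure.-integrable `[a, x] (EFin \o g1).
    by apply: integrableS i1.
  have i2' : lebesgue_measure.-integrable `[a, x] (EFin \o g2).
    by apply: integrableS i2.
  rewrite RintegralB// /Rintegral -(E1 x ax xb) -(E2 x ax xb) /=.
  by ring.
Qed.

(** Lebesgue differentiation gives the derivative of the indefinite integral of [g] almost
    everywhere, and near an interior point [F] is that integral up to a constant. *)
Lemma ac_derivative (a b : R) F : a < b -> ac a b F -> exists g,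
  [/\ measurable_fun setT (g : measurableTypeR R -> R),
      (@lebesgue_measure R).-integrable setT (EFin \o g),
      F b - F a = \int[lebesgue_measure]_(t in `[a, b]) g t &
      {ae (@lebesgue_measure R), forall x, a < x < b -> is_derive x 1 F (g x)}].
Proof.
move=> ab acF; have [g [mg ig gE]] := ac_density ab acF.
exists g; split => //; first by apply: gE => //; exact: ltW.
have locg : locally_integrable setT g by apply: open_integrable_locally => //; exact: openT.
have igy y : lebesgue_measure.-integrable [set` Interval (BLeft a) (BRight y)] (EFin \o g).
  by apply: integrableS ig.
have := FTC1 igy locg; apply: filterS; first exact: (ae_filter_ringOfSetsType (@lebesgue_measure R)).
move=> x /= H /andP[ax xb]; have [|dH Hx] := H; first by rewrite lte_fin.
pose K (y : R) : R := F a + \int[lebesgue_measure]_(t in `[a, y]) g t.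
have dK : is_derive x 1 K (g x).
  have dH' : is_derive x 1 (fun y => \int[lebesgue_measure]_(t in `[a, y]) g t) (g x).
    by rewrite -Hx derive1E; exact: derivableP.
  have := is_deriveD (is_derive_cst (F a) x 1) dH'.
  by rewrite add0r.
apply: (near_eq_is_derive _ dK).
near=> y; rewrite /K -gE; first by rewrite addrC subrK.
  by near: y; exact: lt_le_nbhsr.
by near: y; exact: lt_le_nbhsl.
Unshelve. all: by end_near. Qed.

End ac_ftc.

(** * Integration by parts *)

Section borel_vs_lebesgue.
Context (R : realType).

Lemma borel_lebesgue_measurable d' (U : measurableType d') (f : R -> U) :
  measurable_fun setT (f : measurableTypeR R -> U) -> measurable_fun setT (f : lebesgueType R -> U).
Proof. by move=> mf _ A mA; apply: sub_caratheodory; exact: mf. Qed.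

(** The identity is measurable from Lebesgue sets to Borel sets and pushes the completed measure to
    the Borel one. *)
Lemma borel_lebesgue_integral (D : set R) (f : R -> \bar R) :
  measurable (D : set (measurableTypeR R)) ->
  measurable_fun setT (f : measurableTypeR R -> \bar R) ->
  (\int[lebesgue_measure]_(x in D) f x = \int[lebesgue]_(x in (D : set (lebesgueType R))) f x)%E.
Proof.
move=> mD mf.
have mid : measurable_fun setT (idfun : lebesgueType R -> measurableTypeR R).
  by move=> _ A mA; rewrite setTI; exact: sub_caratheodory.
have H (g : R -> \bar R) : measurable_fun setT (g : measurableTypeR R -> \bar R) ->
    (forall x, 0 <= g x)%E ->
    (\int[lebesgue_measure]_(x in D) g x = \int[lebesgue]_(x in (D : set (lebesgueType R))) g x)%E.
  move=> mg g0.
  rewrite -[RHS](@ge0_integral_pushforward _ _ (lebesgueType R) (measurableTypeR R) R idfun mid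
    (@completed_lebesgue_measure R) D g)//; last exact: measurable_funTS.
rewrite integralE [RHS]integralE; congr (_ - _)%E; apply: H => //.
- exact: measurable_funepos.
- exact: measurable_funeneg.
Qed.

Lemma continuous_bounded_segment (p : R -> R) (a b : R) : a <= b -> continuous p ->
  exists2 M : R, 0 <= M & forall x, a <= x <= b -> `|p x| <= M.
Proof.
move=> ab cp.
have cn : {within `[a, b], continuous (fun x => `|p x|)}.
  apply: continuous_subspaceT => x.
  by apply: continuous_comp; [exact: cp|exact: norm_continuous].
have [c _ H] := EVT_max ab cn.
exists `|p c| => // x xab; apply: H; by rewrite in_itv.
Qed.

Lemma continuous_pintegrable (p : R -> R) : continuous p -> pintegrable p.
Proof.
move=> cp; have [M M0 HM] := @continuous_bounded_segment p (- pi) pi (ge0_cp (pi_ge0 R)).2 cp.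
split; apply: measurable_bounded_integrable.
- exact: measurable_period_itv.
- by rewrite [ltLHS]lebesgue_period_itv ltry.
- by apply: measurable_funTS; exact: continuous_lebesgue_measurable.
- exists M; split; first exact: ger0_real.
  move=> N MN x; rewrite /period_itv /= in_itv /= => Px.
  exact: le_trans (HM x Px) (ltW MN).
Qed.

End borel_vs_lebesgue.

Section by_parts.
Context (R : realType).
Implicit Types (F p q phi dphi : R -> R).

Lemma lipschitz_ac (a b L : R) F : 0 <= L ->
  (forall x y, a <= x -> x <= y -> y <= b -> `|F y - F x| <= L * (y - x)) -> ac a b F.
Proof.
move=> L0 FL e e0; have L1 : 0 < L + 1 by rewrite ltr_wpDl.
exists (e / (L + 1)) => [|s /andP[sa _]]; first exact: divr_gt0.
rewrite ltr_pdivlMr// => sd; apply: le_lt_trans sd.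
rewrite /total_oscillation /total_length mulr_suml big_seq [leRHS]big_seq.
apply: ler_sum => q /(allP sa)/and3P[h1 h2 h3].
apply: (le_trans (FL _ _ h1 h2 h3)); rewrite mulrC ler_wpM2l ?subr_ge0//.
by rewrite lerDl.
Qed.

Lemma derive_lipschitz (L : R) phi dphi (a b : R) :
  (forall x, a <= x <= b -> is_derive x 1 phi (dphi x)) ->
  (forall x, a <= x <= b -> `|dphi x| <= L) ->
  forall x y, a <= x -> x <= y -> y <= b -> `|phi y - phi x| <= L * (y - x).
Proof.
move=> dp pL x y ax xy yb.
have inab z : x <= z <= y -> a <= z <= b.
  by move=> /andP[h1 h2]; rewrite (le_trans ax h1) (le_trans h2 yb).
have [||z zxy ->] := @MVT_segment R phi dphi x y xy _ _.
- by move=> z; rewrite in_itv /= => /andP[h1 h2]; apply/dp/inab; rewrite !ltW.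
- apply: derivable_within_continuous => z; rewrite in_itv /= => /inab/dp dz.
  exact: ex_derive.
- rewrite normrM [`|y - x|]ger0_norm ?subr_ge0// ler_wpM2r ?subr_ge0//.
  by apply: pL; apply: inab; move: zxy; rewrite in_itv.
Qed.

Lemma acM_lipschitz (a b L M : R) F phi : 0 <= L -> 0 <= M ->
  (forall x, a <= x <= b -> `|F x| <= M) ->
  (forall x, `|phi x| <= 1) ->
  (forall x y, a <= x -> x <= y -> y <= b -> `|phi y - phi x| <= L * (y - x)) ->
  ac a b F -> ac a b (fun x => F x * phi x).
Proof.
move=> L0 M0 FM p1 pL acF e e0; have e2 : 0 < e / 2 by rewrite divr_gt0.
have [d d0 H] := acF _ e2.
(* The term [F x * (phi y - phi x)] is at most [M * L * (y - x)], that is, the oscillation of this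
   linear function. *)
have acl : ac a b (fun x => M * L * x).
  apply: (@lipschitz_ac a b (M * L)); first exact: mulr_ge0.
  move=> x y _ xy _; rewrite -mulrBr normrM [`|y - x|]ger0_norm ?subr_ge0//.
  by rewrite ger0_norm// mulr_ge0.
have [d' d'0 H'] := acl _ e2.
exists (Num.min d d') => [|s sab]; first by rewrite lt_min d0.
rewrite lt_min => /andP[/(H _ sab) h1 /(H' _ sab) h2].
apply: (@le_lt_trans _ _ (total_oscillation F s + total_oscillation (fun x => M * L * x) s)); last by lra.
have /andP[/allP sa _] := sab.
rewrite /total_oscillation -big_split big_seq [leRHS]big_seq; apply: ler_sum => -[x y] /sa /and3P[/= ax xy yb].
rewrite (_ : _ - _ = (F y - F x) * phi y + F x * (phi y - phi x)); last by ring.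
apply: (le_trans (ler_normD _ _)); apply: lerD.
  by rewrite normrM ler_piMr.
rewrite normrM -mulrBr normrM (ger0_norm (mulr_ge0 M0 L0)) [`|y - x|]ger0_norm ?subr_ge0//.
rewrite -mulrA; apply: ler_pM => //; last exact: pL.
by apply: FM; rewrite ax (le_trans xy).
Qed.

(** The product [F * phi] is absolutely continuous, so the integral of its almost everywhere
    derivative is the difference of its values at [pi] and [- pi], which is 0 by periodicity. *)
Lemma pint_by_parts (L : R) F phi dphi :
  continuous F -> (forall x, F (x + 2 * pi) = F x) -> ac (- pi) pi F ->
  measurable_fun setT ((derive1 F) : lebesgueType R -> R) -> pintegrable (derive1 F) ->
  (forall x : R, is_derive x 1 phi (dphi x)) -> continuous dphi ->
  (forall x, phi (x + 2 * pi) = phi x) ->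
  (forall x, `|phi x| <= 1) -> 0 <= L -> (forall x, `|dphi x| <= L) ->
  pint (fun x => (derive1 F) x * phi x) = - pint (fun x => F x * dphi x).
Proof.
move=> cF pF acF mdF idF dphiE cdphi pphi phi1 L0 dphiL.
have pip : - pi < pi :> R by rewrite gtrN ?pi_gt0.
have cphi : continuous phi.
  move=> x; apply/differentiable_continuous/derivable1_diffP.
  exact: ex_derive.
have [M M0 FM] := continuous_bounded_segment (ltW pip) cF.
have phiL : forall x y, - pi <= x -> x <= y -> y <= pi -> `|phi y - phi x| <= L * (y - x).
  exact: (derive_lipschitz (fun x _ => dphiE x) (fun x _ => dphiL x)).
have acFp := acM_lipschitz L0 M0 FM phi1 phiL acF.
have [g [mg ig gE gD]] := ac_derivative pip acF.
have [h [mh ih hE hD]] := ac_derivative pip acFp.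
have I1 : pintegrable (fun x => (derive1 F) x * phi x).
  apply: (pintegrable_le (q := fun x => `|(derive1 F) x|)).
  - exact: (measurable_funM mdF (continuous_lebesgue_measurable cphi)).
  - by move=> x; rewrite normrM ler_piMr.
  - case: idF => idF; split; exact: integrable_norm.
have I2 : pintegrable (fun x => F x * dphi x).
  by apply: continuous_pintegrable => x; apply: cvgM; [exact: cF|exact: cdphi].
apply/eqP; rewrite -subr_eq0 opprK -(pintD I1 I2).
have -> : pint (fun x => (derive1 F) x * phi x + F x * dphi x) = pint h.
  have mhE : measurable_fun setT (h : lebesgueType R -> R) := borel_lebesgue_measurable mh.
  rewrite /pint /Rintegral; congr fine; apply: ae_eq_integral.
  - exact: measurable_period_itv.
  - apply/measurable_EFinP; apply: measurable_funTS.
    exact: (measurable_funD (measurable_funM mdF (continuous_lebesgue_measurable cphi))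
      (measurable_funM (continuous_lebesgue_measurable cF) (continuous_lebesgue_measurable cdphi))).
  - by apply/measurable_EFinP; apply: measurable_funTS.
  (* Outside [N] and the endpoints, [F] and [F * phi] have derivatives [g] and [h], and the product
     rule applies; on the excluded null set [derive1 F] may be a default value. *)
  - pose N := ~` [set x : R | (- pi < x < pi -> is_derive x 1 F (g x)) /\
                     (- pi < x < pi -> is_derive x 1 (fun x => F x * phi x) (h x))].
    have nN : (@lebesgue_measure R).-negligible (N `|` [set - pi; pi]).
      apply: negligibleU.
        exact: (@filterI _ _ (ae_filter_ringOfSetsType (@lebesgue_measure R)) _ _ gD hD).
      exists [set - pi; pi]; split => //.
        by apply: measurableU; exact: measurable_set1.
      apply: countable_lebesgue_measure0; apply: finite_set_countable.
      by rewrite finite_setU; split; exact: finite_set1.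
    apply: negligibleS (negligible_lebesgueE nN) => x /= Hx.
    apply: contrapT => /not_orP[/contrapT [H1 H2] Nx]; apply: Hx => Px.
    have xpi : - pi < x < pi.
      move: Px; rewrite /period_itv /= in_itv /= => /andP[px xp].
      rewrite !lt_neqAle px xp !andbT; apply/andP; split; apply/eqP => E; apply: Nx.
        by left.
      by right.
    have dF := H1 xpi; have dFp := H2 xpi.
    have E1 : (derive1 F) x = g x by rewrite derive1E derive_val.
    have := is_deriveM dF (dphiE x) => dm.
    have E2 : h x = F x * dphi x + phi x * g x.
      have := @derive_val _ _ _ _ _ _ _ dFp.
      by rewrite -[fun x => _]/(F * phi) (@derive_val _ _ _ _ _ _ _ dm).
    by rewrite E1 E2 addrC [phi x * _]mulrC.
rewrite /pint /Rintegral -borel_lebesgue_integral; last 2 first.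
- exact: measurable_itv.
- by apply/measurable_EFinP.
rewrite -[fine _]/(\int[lebesgue_measure]_(t in `[- pi, pi]) h t) -hE.
have piE : pi = - pi + 2 * pi :> R by ring.
by rewrite {1 2}piE pF pphi subrr.
Qed.

Lemma ac_continuous F : (forall a b, a <= b -> ac a b F) -> continuous F.
Proof.
move=> acF x; apply/cvgrPdist_lt => e e0.
have x11 : x - 1 <= x + 1 by lra.
have [d d0 H] := acF _ _ x11 e e0.
have d1 : 0 < Num.min d 1 by rewrite lt_min d0 ltr01.
near=> y.
have : `|x - y| < Num.min d 1 by near: y; apply/nbhs_ballP; exists (Num.min d 1).
rewrite lt_min => /andP[yx]; rewrite ltr_norml => /andP[y1 y2].
have [xy|xy] := leP x y.
  have := H [:: (x, y)]; rewrite /total_length /total_oscillation !big_seq1 /= distrC.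
  apply; last by rewrite (le_lt_trans _ yx)// distrC ler_norm.
  by apply: subintervals1 => //; lra.
have := H [:: (y, x)]; rewrite /total_length /total_oscillation !big_seq1 /=.
apply; last by rewrite (le_lt_trans _ yx)// ler_norm.
by apply: subintervals1; lra.
Unshelve. all: by end_near. Qed.

Lemma derive1_periodic F (c : R) : (forall x, F (x + c) = F x) ->
  forall x, (derive1 F) (x + c) = (derive1 F) x.
Proof.
move=> pF x; rewrite /derive1 pF.
suff -> : (fun h : R => h^-1 *: (F (h + (x + c)) - F x)) = (fun h => h^-1 *: (F (h + x) - F x)) by [].
by apply/funext => h; rewrite addrA pF.
Qed.

Section sobolev.
Variables (r : nat) (p : R -> R).
Hypotheses (r0 : (0 < r)%N) (pp : forall x, p (x + 2 * pi) = p x)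
  (dp : forall k x, (k < r.-1)%N -> derivable (derive1n k p) x 1)
  (acp : forall a b, a <= b -> ac a b (derive1n r.-1 p))
  (mp : measurable_fun setT (derive1n r p : lebesgueType R -> R))
  (ip : pintegrable (derive1n r p)).

Lemma derive1n_periodic j x : derive1n j p (x + 2 * pi) = derive1n j p x.
Proof. by elim: j x => [|j IH] x; [exact: pp|exact: derive1_periodic]. Qed.

Lemma derive1n_continuous j : (j < r)%N -> continuous (derive1n j p).
Proof.
move=> jr; have [jr1|jr1] := ltnP j r.-1.
  by move=> x; apply/differentiable_continuous/derivable1_diffP; exact: dp.
have -> : j = r.-1 by apply/eqP; rewrite eqn_leq jr1 andbT -ltnS prednK.
exact: ac_continuous.
Qed.

(** For [j < r.-1] the next derivative is continuous, so the [j]-th one is Lipschitz on the period;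
    for [j = r.-1] absolute continuity is given. *)
Lemma derive1n_by_parts j (L : R) phi dphi : (j < r)%N ->
  (forall x : R, is_derive x 1 phi (dphi x)) -> continuous dphi ->
  (forall x, phi (x + 2 * pi) = phi x) ->
  (forall x, `|phi x| <= 1) -> 0 <= L -> (forall x, `|dphi x| <= L) ->
  pintegrable (derive1n j.+1 p) /\
  pint (fun x => derive1n j.+1 p x * phi x) = - pint (fun x => derive1n j p x * dphi x).
Proof.
move=> jr h1 h2 h3 h4 h5 h6.
have pip : - pi <= pi :> R by rewrite ge0_cp ?pi_ge0.
have cj := derive1n_continuous jr.
have [jr1|jr1] := ltnP j r.-1; last first.
  have jE : j = r.-1 by apply/eqP; rewrite eqn_leq jr1 andbT -ltnS prednK.
  have jE1 : j.+1 = r by rewrite jE prednK.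
  split; first by rewrite jE1.
  apply: (@pint_by_parts L _ _ _ cj (derive1n_periodic j) _ _ _ h1 h2 h3 h4 h5 h6).
  - by rewrite jE; exact: acp.
  - by have := mp; rewrite -jE1.
  - by have := ip; rewrite -jE1.
have cj1 : continuous (derive1n j.+1 p) by apply: derive1n_continuous; rewrite -ltn_predRL.
split; first exact: continuous_pintegrable.
apply: (@pint_by_parts L _ _ _ cj (derive1n_periodic j) _ _ _ h1 h2 h3 h4 h5 h6).
- have [M M0 HM] := continuous_bounded_segment pip cj1.
  have dj (x : R) : is_derive x 1 (derive1n j p) (derive1n j.+1 p x).
    by rewrite /= derive1E; apply/derivableP; exact: dp.
  exact: (lipschitz_ac M0 (derive_lipschitz (fun x _ => dj x) HM)).
- exact: continuous_lebesgue_measurable.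
- exact: continuous_pintegrable.
Qed.

End sobolev.

End by_parts.

(** * Fourier coefficients of derivatives *)

Section fourier_derivative.
Context (R : realType).
Local Notation C := R[i].
Implicit Types (f : R -> C).

Lemma csqint_continuous f : continuous (fun x => complex.Re (f x)) ->
  continuous (fun x => complex.Im (f x)) -> csqint f.
Proof.
move=> cr ci.
have mf : cmeasurable f by split; exact: continuous_lebesgue_measurable.
split => //.
have cN : continuous (fun x => Normc.normc (f x) ^+ 2).
  rewrite (_ : (fun x => _) = (fun x => complex.Re (f x) * complex.Re (f x) + complex.Im (f x) * complex.Im (f x))).
    by move=> x; apply: cvgD; apply: cvgM; [exact: cr|exact: cr|exact: ci|exact: ci].
  by apply/funext => x; rewrite normc_sq -!expr2.
have [/integrableP[_]] := continuous_pintegrable cN.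
apply: le_lt_trans; rewrite le_eqVlt; apply/orP; left; apply/eqP.
by apply: eq_integral => x _ /=; rewrite ger0_norm// sqr_ge0.
Qed.

Section coefficients.
Variables (r : nat) (f : R -> C).
Hypotheses (r0 : (0 < r)%N) (Wf : in_W2 r f).

Let p := fun x => complex.Re (f x).
Let q := fun x => complex.Im (f x).

Let pp x : p (x + 2 * pi) = p x.
Proof. by rewrite /p; case: Wf => ->. Qed.
Let pq x : q (x + 2 * pi) = q x.
Proof. by rewrite /q; case: Wf => ->. Qed.
Let dp k x : (k < r.-1)%N -> derivable (derive1n k p) x 1.
Proof. by case: Wf => _ H _ _ kr; case: (H k x kr). Qed.
Let dq k x : (k < r.-1)%N -> derivable (derive1n k q) x 1.
Proof. by case: Wf => _ H _ _ kr; case: (H k x kr). Qed.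
Let acp a b : a <= b -> ac a b (derive1n r.-1 p).
Proof.
case: Wf => _ _ H _ ab.
have -> : derive1n r.-1 p = (fun x => complex.Re (cderiv r.-1 f x)) by [].
exact: (abs_continuous_on_ac (@normc_Re_sub R) (H a b ab)).
Qed.
Let acq a b : a <= b -> ac a b (derive1n r.-1 q).
Proof.
case: Wf => _ _ H _ ab.
have -> : derive1n r.-1 q = (fun x => complex.Im (cderiv r.-1 f x)) by [].
exact: (abs_continuous_on_ac (@normc_Im_sub R) (H a b ab)).
Qed.
Let If : csqint (cderiv r f).
Proof. by case: Wf => _ _ _ /in_L2P[]. Qed.
Let mp : measurable_fun setT (derive1n r p : lebesgueType R -> R).
Proof. exact: (cmeasurable_Re (csqint_measurable If)). Qed.
Let mq : measurable_fun setT (derive1n r q : lebesgueType R -> R).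
Proof. exact: (cmeasurable_Im (csqint_measurable If)). Qed.
Let ip : pintegrable (derive1n r p).
Proof. exact: (cintegrable_Re (csqint_integrable If)). Qed.
Let iq : pintegrable (derive1n r q).
Proof. exact: (cintegrable_Im (csqint_integrable If)). Qed.

Lemma csqint_cderiv j : (j < r)%N -> csqint (cderiv j f).
Proof.
move=> jr; apply: csqint_continuous.
  exact: (derive1n_continuous r0 dp acp jr).
exact: (derive1n_continuous r0 dq acq jr).
Qed.

Lemma csqint_W2 : csqint f.
Proof.
have := csqint_cderiv r0; rewrite (_ : cderiv 0 f = f)//.
by apply/funext => x; rewrite /cderiv /=; case: (f x).
Qed.

(** Real and imaginary parts are integrated by parts against [cos (c * x)] and [sin (c * x)]
    separately; the four real identities make up the complex one. The bound on the derivatives of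
    the test functions is [|c|]. *)
Lemma fourier_cderivS j (k : int) : (j < r)%N ->
  fourier (cderiv j.+1 f) k = (0 +i* k%:~R) * fourier (cderiv j f) k.
Proof.
move=> jr; set c : R := k%:~R.
have dcos (x : R) : is_derive x 1 (fun x => cos (c * x)) (- c * sin (c * x)).
  have h : is_derive x 1 (fun x => c * x) c.
    by have := is_deriveZ c (is_derive_id x 1); rewrite [c *: 1]mulr1.
  by have := is_derive1_comp (is_derive_cos (c * x)) h; rewrite mulNr mulrC -mulNr.
have dsin (x : R) : is_derive x 1 (fun x => sin (c * x)) (c * cos (c * x)).
  have h : is_derive x 1 (fun x => c * x) c.
    by have := is_deriveZ c (is_derive_id x 1); rewrite [c *: 1]mulr1.
  by have := is_derive1_comp (is_derive_sin (c * x)) h; rewrite mulrC.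
have [/= pcos psin] : (forall x : R, cos (c * (x + 2 * pi)) = cos (c * x)) /\
    (forall x : R, sin (c * (x + 2 * pi)) = sin (c * x)).
  by split=> x; have := cis_periodic k x => /eqP; rewrite eq_complex /= => /andP[/eqP ? /eqP ?].
have ccos : continuous (fun x : R => cos (c * x)).
  move=> x; apply/differentiable_continuous/derivable1_diffP; have := dcos x => ?; exact: ex_derive.
have csin : continuous (fun x : R => sin (c * x)).
  move=> x; apply/differentiable_continuous/derivable1_diffP; have := dsin x => ?; exact: ex_derive.
have cdcos : continuous (fun x : R => - c * sin (c * x)).
  by move=> x; apply: cvgM; [exact: cvg_cst|exact: csin].
have cdsin : continuous (fun x : R => c * cos (c * x)).
  by move=> x; apply: cvgM; [exact: cvg_cst|exact: ccos].
have cos1 (x : R) : `|cos (c * x)| <= 1 by rewrite ler_norml cos_geN1 cos_le1.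
have sin1 (x : R) : `|sin (c * x)| <= 1 by rewrite ler_norml sin_geN1 sin_le1.
have bcos (x : R) : `|- c * sin (c * x)| <= `|c| by rewrite normrM normrN ler_piMr.
have bsin (x : R) : `|c * cos (c * x)| <= `|c| by rewrite normrM ler_piMr.
have [ipj pc] := derive1n_by_parts r0 pp dp acp mp ip jr dcos cdcos pcos cos1 (normr_ge0 c) bcos.
have [_ ps] := derive1n_by_parts r0 pp dp acp mp ip jr dsin cdsin psin sin1 (normr_ge0 c) bsin.
have [iqj qc] := derive1n_by_parts r0 pq dq acq mq iq jr dcos cdcos pcos cos1 (normr_ge0 c) bcos.
have [_ qs] := derive1n_by_parts r0 pq dq acq mq iq jr dsin cdsin psin sin1 (normr_ge0 c) bsin.
have cpj := derive1n_continuous r0 dp acp jr.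
have cqj := derive1n_continuous r0 dq acq jr.
have int_cont (g h : R -> R) : continuous g -> continuous h -> pintegrable (fun x => g x * h x).
  by move=> cg ch; apply: continuous_pintegrable => x; apply: cvgM; [exact: cg|exact: ch].
have int_bd (g h : R -> R) : measurable_fun setT (g : lebesgueType R -> R) -> pintegrable g ->
    continuous h -> (forall x, `|h x| <= 1) -> pintegrable (fun x => g x * h x).
  move=> mg [ig] ch h1; apply: (pintegrable_le (q := fun x => `|g x|)).
  - exact: (measurable_funM mg (continuous_lebesgue_measurable ch)).
  - by move=> x; rewrite normrM ler_piMr.
  - by split; exact: integrable_norm.
have mj : cmeasurable (cderiv j.+1 f).
  have [h|h] := ltnP j.+1 r; first exact: (csqint_measurable (csqint_cderiv h)).
  have -> : j.+1 = r by apply/eqP; rewrite eqn_leq jr h.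
  exact: csqint_measurable If.
have mpj := cmeasurable_Re mj; have mqj := cmeasurable_Im mj.
have E (g : nat -> R -> C) i x : complex.Re (g i x * cis (- c * x)) =
    complex.Re (g i x) * cos (c * x) + complex.Im (g i x) * sin (c * x) /\
    complex.Im (g i x * cis (- c * x)) =
    complex.Im (g i x) * cos (c * x) - complex.Re (g i x) * sin (c * x).
  by rewrite ReMc ImMc /= mulNr cosN sinN; split; ring.
have cintE i : pintegrable (fun x => derive1n i p x * cos (c * x)) ->
    pintegrable (fun x => derive1n i p x * sin (c * x)) ->
    pintegrable (fun x => derive1n i q x * cos (c * x)) ->
    pintegrable (fun x => derive1n i q x * sin (c * x)) ->
    cint (fun x => cderiv i f x * cis (- c * x)) =
    (pint (fun x => derive1n i p x * cos (c * x)) + pint (fun x => derive1n i q x * sin (c * x)))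
    +i* (pint (fun x => derive1n i q x * cos (c * x)) - pint (fun x => derive1n i p x * sin (c * x))).
  move=> h1 h2 h3 h4; rewrite -(pintD h1 h4) -(pintB h3 h2) /cint; congr (_ +i* _).
    by congr pint; apply/funext => x; rewrite (E (fun i => cderiv i f) i x).1.
  by congr pint; apply/funext => x; rewrite (E (fun i => cderiv i f) i x).2.
have K1 := int_cont _ _ cpj ccos; have K2 := int_cont _ _ cpj csin.
have K3 := int_cont _ _ cqj ccos; have K4 := int_cont _ _ cqj csin.
rewrite !fourierE (cintE j K1 K2 K3 K4).
rewrite (cintE j.+1 (int_bd _ _ mpj ipj ccos cos1) (int_bd _ _ mpj ipj csin sin1)
  (int_bd _ _ mqj iqj ccos cos1) (int_bd _ _ mqj iqj csin sin1)).
rewrite pc ps qc qs.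
have scale (g h : R -> R) (t : R) : pintegrable (fun x => g x * h x) ->
    pint (fun x => g x * (t * h x)) = t * pint (fun x => g x * h x).
  by move=> gh; rewrite -(pintZ t gh); congr pint; apply/funext => x; rewrite mulrCA.
rewrite !scale//.
by apply: eq_complexP; rewrite /=; ring.
Qed.

Lemma fourier_cderiv (k : int) : fourier (cderiv r f) k = (0 +i* k%:~R) ^+ r * fourier f k.
Proof.
have f0 : cderiv 0 f = f by apply/funext => x; rewrite /cderiv /=; case: (f x).
suff H j : (j <= r)%N -> fourier (cderiv j f) k = (0 +i* k%:~R) ^+ j * fourier f k by exact: H.
elim: j => [_|j IH jr].
  by rewrite expr0 mul1r f0.
by rewrite (fourier_cderivS k jr) (IH (ltnW jr)) mulrA -exprS.
Qed.

End coefficients.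

Lemma normc_fourier_cderiv r f (k : int) : (0 < r)%N -> in_W2 r f ->
  Normc.normc (fourier (cderiv r f) k) ^+ 2 = k%:~R ^+ (2 * r) * Normc.normc (fourier f k) ^+ 2.
Proof.
move=> r0 Wf; rewrite (fourier_cderiv r0 Wf) normc_sqM; congr (_ * _).
have -> : Normc.normc ((0 +i* k%:~R : C) ^+ r) = Normc.normc (0 +i* k%:~R : C) ^+ r.
  elim: r {r0 Wf} => [|r IH]; first by rewrite !expr0 Normc.normc1.
  by rewrite !exprS Normc.normcM IH.
by rewrite -exprM mulnC exprM normc_sq /= expr0n add0r -exprM.
Qed.

End fourier_derivative.

(** * Fourier coefficients of the averages *)

Section shifts.
Context (R : realType).
Local Notation C := R[i].
Implicit Types (f B u : R -> C) (k l : int).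

Lemma fourier_shift (s : R) f k : 0 <= s <= 2 * pi -> periodic2pi f -> csqint f ->
  fourier (fun x => f (x - s)) k = cis (- k%:~R * s) * fourier f k.
Proof.
move=> s2 pf If; rewrite !fourierE [RHS]mulrCA; congr (_ * _).
pose g x := f x * cis (- k%:~R * x).
have Ig : csqint g := csqintM_cis _ If.
have pg : periodic2pi g.
  by move=> x; rewrite /g pf; have := cis_periodic (- k) x; rewrite mulrNz => ->.
rewrite -/g -(cint_shift s2 pg (csqint_measurable Ig)).
rewrite -(cintZ _ (csqint_integrable (csqint_shift s2 pg Ig))).
congr cint; apply/funext => x; rewrite /g mulrCA -cisD; congr (_ * cis _).
by ring.
Qed.

Lemma fourier_reflect f k : csqint f -> fourier (fun x => f (- x)) k = fourier f (- k).
Proof.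
move=> If; rewrite !fourierE; congr (_ * _).
rewrite -(cint_reflect (csqint_measurable (csqintM_cis (- (- k)%:~R) If))).
by congr cint; apply/funext => x; rewrite mulrNz opprK mulrN mulNr.
Qed.

Lemma even_part_csqint f : csqint f -> csqint (even_part f).
Proof.
move=> If; have := csqintZ 2^-1 (csqintD If (csqint_reflect If)).
rewrite (_ : (fun x => _) = even_part f)//.
by apply/funext => x; rewrite /even_part mulrC.
Qed.

Lemma fourier_even_part f k : csqint f ->
  fourier (even_part f) k = (fourier f k + fourier f (- k)) / 2.
Proof.
move=> If; rewrite -(fourier_reflect k If) -(fourierD k If (csqint_reflect If)) mulrC.
rewrite -(fourierZ _ k (csqintD If (csqint_reflect If))).
suff -> : even_part f = (fun x => 2^-1 * (f x + f (- x))) by [].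
by apply/funext => x; rewrite /even_part mulrC.
Qed.

Lemma cisMn (t : R) (j : nat) : cis (t * j%:R) = cis t ^+ j.
Proof.
elim: j => [|j IH]; first by rewrite mulr0 cis0 expr0.
by rewrite -natr1 mulrDr mulr1 cisD IH exprSr.
Qed.

Lemma cis_neq1 (t : R) : 0 < t < 2 * pi -> cis t != 1.
Proof.
move=> /andP[t0 t2]; apply/eqP => -[c1 _].
have s0 : 0 < sin (t / 2).
  by apply: sin_gt0_pi; rewrite divr_gt0//= ltr_pdivrMr// mulrC.
have := cosD (t / 2) (t / 2); rewrite -splitr c1 -!expr2 cos2sin2.
by have := exprn_gt0 2 s0; lra.
Qed.

Section averages.
Variables (B : R -> C) (n : nat).
Hypotheses (n0 : (0 < n)%N) (IB : csqint B) (pB : periodic2pi B).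

Let twon : int := 2 * n%:Z.

Let shift_itv (j : 'I_(2 * n)) : 0 <= (j%:R * pi / n%:R : R) <= 2 * pi.
Proof.
have n0R : 0 < n%:R :> R by rewrite ltr0n.
rewrite divr_ge0 ?mulr_ge0 ?pi_ge0 ?ler0n//= ler_pdivrMr//.
rewrite mulrAC ler_wpM2r ?pi_ge0// -natrM ler_nat.
exact: ltnW.
Qed.

(** The translation by [j * pi / n] multiplies the [k]-th coefficient by a power of an exponential,
    so the average is a geometric sum in [w], a [2 * n]-th root of unity that equals 1 exactly when
    [2 * n] divides [k - l]. *)
Lemma Phi_fourier l k : csqint (Phi B n l) /\
  fourier (Phi B n l) k = if (twon %| k - l)%Z then fourier B k else 0.
Proof.
have n0R : n%:R != 0 :> R by rewrite pnatr_eq0 -lt0n.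
pose F (j : 'I_(2 * n)) (x : R) : C :=
  cis (l%:~R * j%:R * pi / n%:R) * B (x - j%:R * pi / n%:R).
have IF j : csqint (F j) := csqintZ _ (csqint_shift (shift_itv j) pB IB).
have [IS fS] := fourier_sum (index_enum _) k IF.
split; first exact: csqintZ _ IS.
have -> : fourier (Phi B n l) k = ((2 * n)%N%:R)^-1 * \sum_j fourier (F j) k.
  by rewrite -fS -(fourierZ _ k IS).
pose w : C := cis ((l - k)%:~R * pi / n%:R).
have -> : \sum_j fourier (F j) k = \sum_(j < 2 * n) w ^+ j * fourier B k.
  apply: eq_bigr => j _.
  rewrite (fourierZ _ k (csqint_shift (shift_itv j) pB IB)) (fourier_shift k (shift_itv j) pB IB).
  rewrite mulrA -cisD /w -cisMn; congr (cis _ * _).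
  by rewrite intrB; field.
rewrite -mulr_suml.
have n2 : (2 * n)%N%:R != 0 :> C by rewrite pnatr_eq0 -lt0n muln_gt0 n0.
have [/dvdzP[q qE]|nd] := boolP (twon %| k - l)%Z.
  have -> : w = 1.
    rewrite /w -(opprB k l) qE -[RHS](cis0) -[in RHS](cis_2pik 0 (- q)); congr cis.
    by rewrite /twon !(mulrNz, intrM) -pmulrn; field.
  under eq_bigr do rewrite expr1n.
  by rewrite sumr_const card_ord mulrA mulVf// mul1r.
have w1 : w != 1.
  (* The remainder lies strictly between 0 and [2 * n], which puts the argument of [w] strictly
     between 0 and [2 * pi]. *)
  pose d := ((l - k) %% twon)%Z.
  have t0 : 0 < twon by rewrite /twon; lia.
  have d0 : 0 <= d by apply: modz_ge0; rewrite gt_eqF.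
  have d2 : d < twon by apply: ltz_pmod.
  have dn : d != 0.
    apply: contra nd => /eqP dE.
    have /dvdzP[q qE] : (twon %| l - k)%Z by apply/dvdz_mod0P.
    by apply/dvdzP; exists (- q); rewrite -opprB qE mulNr.
  have -> : w = cis (d%:~R * pi / n%:R).
    rewrite /w {1}(divz_eq (l - k) twon) -/d -[RHS](cis_2pik _ ((l - k) %/ twon)%Z); congr cis.
    by rewrite /twon intrD !intrM -pmulrn; field.
  apply: cis_neq1.
  have dR : 0 < d%:~R :> R by rewrite ltr0z lt_neqAle eq_sym dn.
  have n0' : 0 < n%:R :> R by rewrite ltr0n.
  rewrite divr_gt0 ?mulr_gt0 ?pi_gt0//= ltr_pdivrMr// mulrAC ltr_pM2r ?pi_gt0//.
  by rewrite -[2 * n%:R](_ : twon%:~R = _) ?ltr_int// /twon intrM -pmulrn.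
have : (w - 1) * \sum_(j < 2 * n) w ^+ j = 0.
  rewrite -subrX1 /w -cisMn.
  have -> : (l - k)%:~R * pi / n%:R * (2 * n)%:R = 0 + (l - k)%:~R * (2 * pi) :> R.
    by rewrite natrM; field.
  by rewrite cis_2pik cis0 subrr.
move/eqP; rewrite mulf_eq0 subr_eq0 (negbTE w1) /= => /eqP ->.
by rewrite mul0r mulr0.
Qed.

End averages.

End shifts.

(** * Completing squares on one residue class, and symmetric partial sums *)

Section approximation_algebra.
Context (R : realType).
Local Notation C := R[i].

Lemma residual_identity (lam : R) (x y : C) : lam != 0 -> lam != 1 ->
  lam * Normc.normc x ^+ 2 - Normc.normc (x - y) ^+ 2 =
  Normc.normc y ^+ 2 / (lam^-1 - 1) + Normc.normc ((lam - 1)%:C * x + y) ^+ 2 / (lam - 1).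
Proof.
move=> l0 l1; rewrite !normc_sq !ReD !ImD !ReN !ImN !ReMc !ImMc /=.
move: (complex.Re x) (complex.Im x) (complex.Re y) (complex.Im y) => p q r s.
have l1' : lam - 1 != 0 by rewrite subr_eq0.
have l1'' : 1 - lam != 0 by rewrite subr_eq0 eq_sym.
have -> : lam^-1 - 1 = (1 - lam) / lam by field.
by field; rewrite l0 l1' l1''.
Qed.

Lemma class_inequality (x b : int -> C) (a : C) (lam : int -> R) (N : nat) :
  0 < lam 0 < 1 -> (forall v, v != 0 -> 1 < lam v) -> b 0 != 0 ->
  0 <= \sum_(0 <= i < (2 * N).+1) Normc.normc (b (i%:Z - N%:Z)) ^+ 2 / ((lam (i%:Z - N%:Z))^-1 - 1) ->
  a = (1 - lam 0)%:C * x 0 / b 0 ->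
  \sum_(0 <= i < (2 * N).+1) Normc.normc (x (i%:Z - N%:Z) - a * b (i%:Z - N%:Z)) ^+ 2 <=
  \sum_(0 <= i < (2 * N).+1) lam (i%:Z - N%:Z) * Normc.normc (x (i%:Z - N%:Z)) ^+ 2.
Proof.
move=> /andP[l0 l1] lv b0 H aE; rewrite -subr_ge0 -sumrB.
(* By [residual_identity] this is what remains after dropping the squares over [lam - 1]: they are
   nonnegative for [v != 0], and at [v = 0], where [lam - 1] is negative, [aE] makes the square
   vanish. *)
apply: (@le_trans _ _ (Normc.normc a ^+ 2 *
  \sum_(0 <= i < (2 * N).+1) Normc.normc (b (i%:Z - N%:Z)) ^+ 2 / ((lam (i%:Z - N%:Z))^-1 - 1))).
  by rewrite mulr_ge0// sqr_ge0.
rewrite mulr_sumr; apply: ler_sum => i _.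
move: (i%:Z - N%:Z) => v.
have [v0|v0] := eqVneq v 0.
  rewrite v0 residual_identity ?(gt_eqF l0) ?(lt_eqF l1)//.
  have -> : (lam 0 - 1)%:C * x 0 + a * b 0 = 0.
    by rewrite aE divfK// -mulrDl -rmorphD (_ : lam 0 - 1 + (1 - lam 0) = 0) ?mul0r//; ring.
  by rewrite Normc.normc0 expr0n mul0r addr0 normc_sqM mulrA.
have l1v := lv v v0; have l0v : 0 < lam v by exact: lt_trans l1v.
rewrite residual_identity ?(gt_eqF l0v) ?(gt_eqF l1v)// normc_sqM mulrA lerDl.
by rewrite divr_ge0 ?sqr_ge0// subr_ge0 ltW.
Qed.

Lemma symmetric_sumS (F : int -> R) (N : nat) :
  \sum_(0 <= i < (2 * N.+1).+1) F (i%:Z - N.+1%:Z) =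
  \sum_(0 <= i < (2 * N).+1) F (i%:Z - N%:Z) + (F (- N.+1%:Z) + F N.+1%:Z).
Proof.
have -> : (2 * N.+1).+1 = (2 * N).+3 by lia.
rewrite big_nat_recr//= big_nat_recl//= sub0r.
have -> : (2 * N).+2%:Z - N.+1%:Z = N.+1%:Z by lia.
have -> : \sum_(0 <= i < (2 * N).+1) F (i.+1%:Z - N.+1%:Z) = \sum_(0 <= i < (2 * N).+1) F (i%:Z - N%:Z).
  by apply: eq_bigr => i _; congr F; lia.
by ring.
Qed.

Lemma symmetric_sumN (F : int -> R) (N : nat) :
  \sum_(0 <= i < (2 * N).+1) F (- (i%:Z - N%:Z)) = \sum_(0 <= i < (2 * N).+1) F (i%:Z - N%:Z).
Proof.
rewrite [RHS]big_nat_rev /=; apply: eq_big_nat => i /andP[_ iN]; congr F.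
lia.
Qed.

(** Passing from [N] to [N.+1] adds two nonpositive terms, so the partial sums decrease to their
    limit. The lower bound [M] ensures convergence; without it the limit could be a default
    value. *)
Lemma zsum_le_partial (F : int -> R) (M : R) (N : nat) :
  (forall v, v != 0 -> F v <= 0) ->
  (forall N' : nat, M <= \sum_(0 <= i < (2 * N').+1) F (i%:Z - N'%:Z)) ->
  zsum F <= \sum_(0 <= i < (2 * N).+1) F (i%:Z - N%:Z).
Proof.
move=> F0 FM; pose S (N' : nat) := \sum_(0 <= i < (2 * N').+1) F (i%:Z - N'%:Z).
have -> : zsum F = limn S.
  rewrite /zsum (_ : (fun N' : nat => _) = S)//.
  by apply/funext => N'; rewrite /S big_mkord.
have nS : nonincreasing_seq S.
  apply/nonincreasing_seqP => N'; rewrite /S symmetric_sumS gerDl.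
  have h1 : F (- N'.+1%:Z) <= 0 by apply: F0; lia.
  have h2 : F N'.+1%:Z <= 0 by apply: F0; lia.
  by lra.
apply: (nonincreasing_cvgn_ge nS); apply: nonincreasing_is_cvgn => //.
by exists M => _ [N' _ <-]; exact: FM.
Qed.

Lemma int_pow_le (m : nat) (k : int) (r : nat) : (m <= `|k|)%N ->
  (m%:R ^+ (2 * r) <= k%:~R ^+ (2 * r) :> R).
Proof.
move=> mk; have -> : k%:~R ^+ (2 * r) = (`|k|%N)%:R ^+ (2 * r) :> R.
  by rewrite exprM [RHS]exprM natr_absz intr_norm real_normK ?num_real.
by rewrite lerXn2r ?nnegrE ?ler0n// ler_nat.
Qed.

Lemma int_pow_lt (m : nat) (k : int) (r : nat) : (0 < r)%N -> (m < `|k|)%N ->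
  (m%:R ^+ (2 * r) < k%:~R ^+ (2 * r) :> R).
Proof.
move=> r0 mk; apply: lt_le_trans (int_pow_le r mk).
by rewrite ltrXn2r ?nnegrE ?ler0n ?ltr_nat// muln_eq0 -lt0n r0.
Qed.

Lemma int_pow_gt (m : nat) (k : int) (r : nat) : (0 < r)%N -> (`|k| < m)%N ->
  (k%:~R ^+ (2 * r) < m%:R ^+ (2 * r) :> R).
Proof.
move=> r0 mk; have -> : k%:~R ^+ (2 * r) = (`|k|%N)%:R ^+ (2 * r) :> R.
  by rewrite exprM [RHS]exprM natr_absz intr_norm real_normK ?num_real.
by rewrite ltrXn2r ?nnegrE ?ler0n ?ltr_nat// muln_eq0 -lt0n r0.
Qed.

End approximation_algebra.

(** * The approximant *)

Section residue_windows.
Context (R : realType).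
Variable (n : nat).
Hypothesis n0 : (0 < n)%N.

(** For [i < 2 * n], the residue [i - n + 1] runs through the representatives in []-n, n]]; for
    [j <= 2 * N], the multiple [j - N] runs from [-N] to [N]. *)
Definition window_index (N i j : nat) : int :=
  (i%:Z - n%:Z + 1) + 2 * n%:Z * (j%:Z - N%:Z).

(** A block of consecutive frequencies listed class by class, so that each class contributes a
    symmetric partial sum. *)
Definition window (N : nat) : seq int :=
  [seq window_index N i j | i <- iota 0 (2 * n), j <- iota 0 (2 * N).+1].

Lemma window_uniq N : uniq (window N).
Proof.
apply: allpairs_uniq; rewrite ?iota_uniq//.
move=> -[i j] [i' j'] /allpairsP[p [hp _ [-> ->]]] /allpairsP[q [hq _ [-> ->]]].
move: hp hq; rewrite !mem_iota !add0n; case: p q => [a b] [c d] /= an cn.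
rewrite /window_index => E.
have E2 : (a%:Z - c%:Z) = 2 * n%:Z * (d%:Z - b%:Z) by lia.
have [bd|bd] := eqVneq b d; first by rewrite bd; congr (_, _); lia.
have : (d%:Z - b%:Z <= -1) \/ (1 <= d%:Z - b%:Z) by lia.
by move=> [h|h]; nia.
Qed.

Lemma mem_window N (k : int) : (`|k| <= N)%N -> k \in window N.
Proof.
(* The shift makes the number nonnegative, so that its remainder and quotient modulo [2 * n] are the
   indices [i] and [j]. *)
move=> kN; pose t := `|(k + n%:Z - 1 + 2 * n%:Z * N%:Z)%R|%N.
have tE : t%:Z = k + n%:Z - 1 + 2 * n%:Z * N%:Z by rewrite /t; nia.
have dE := divn_eq t (2 * n).
have h1 : (t %% (2 * n))%N \in iota 0 (2 * n) by rewrite mem_iota add0n leq0n ltn_mod muln_gt0.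
have h2 : (t %/ (2 * n))%N \in iota 0 (2 * N).+1.
  by rewrite mem_iota add0n leq0n ltn_divLR ?muln_gt0//; nia.
apply/allpairsP; exists ((t %% (2 * n))%N, (t %/ (2 * n))%N).
split; [exact: h1|exact: h2|].
by rewrite /window_index /=; move: dE tE; move: (t %/ _)%N (t %% _)%N => a b; nia.
Qed.

Lemma sum_window N (F : int -> R) : \sum_(k <- window N) F k =
  \sum_(0 <= i < 2 * n) \sum_(0 <= j < (2 * N).+1) F (window_index N i j).
Proof. by rewrite big_allpairs_dep /index_iota !subn0. Qed.

Lemma subset_window (s : seq int) : exists N0 : nat, {subset s <= window N0}.
Proof.
exists (\max_(k <- s) `|k|)%N => k ks; apply: mem_window.
by apply: (@leq_bigmax_seq _ s xpredT (fun k : int => `|k|%N)).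
Qed.

End residue_windows.

Lemma dvdz_small (d : nat) (x v : int) : (`|x| < d)%N -> (d%:Z %| x + d%:Z * v)%Z = (x == 0).
Proof.
move=> xd; apply/idP/eqP => [/dvdzP[q E]|->]; last by rewrite add0r dvdz_mulr.
have E' : x = (q - v) * d%:Z by rewrite mulrBl -E; ring.
have [h|[h|h]] : q - v = 0 \/ (q - v <= -1) \/ (1 <= q - v) by lia.
- by rewrite E' h mul0r.
- by move: (q - v) h E' => t h E'; nia.
- by move: (q - v) h E' => t h E'; nia.
Qed.

Lemma mulz_abs_ge (n : nat) (v : int) : v != 0 -> n%:Z <= n%:Z * v \/ n%:Z * v <= - n%:Z.
Proof.
move=> v0; have [h|h] : (v <= -1) \/ (1 <= v) by lia.
  by right; nia.
by left; nia.
Qed.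

(** * The approximant, class by class, and the final estimate *)

Section main.
Context (R : realType) (r n m : nat) (B : R -> R[i]).
Hypotheses (hr : (0 < r)%N) (hm : (0 < m)%N) (hmn : (m <= n)%N)
  (hB : in_L2 B)
  (h2 : forall l : int, 0 <= l <= m%:Z - 1 -> fourier B l != 0)
  (h3 : forall nu : int, nu != 0 -> fourier B (2 * n%:Z * nu) = 0)
  (h4 : forall l : int, 1 <= l <= m%:Z - 1 ->
     0 <= zsum (fun k : int =>
            Normc.normc (fourier B (l + 2 * n%:Z * k)) ^+ 2 /
            (((l + 2 * n%:Z * k)%:~R ^+ (2 * r))^-1
             - (m%:R ^+ (2 * r))^-1) : R)).
Variable u : R -> R[i].
Hypotheses (hu : in_W2 r u) (hue : forall x, u (- x) = u x).

Let hn : (0 < n)%N. Proof. exact: leq_trans hm hmn. Qed.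
Let IB : csqint B. Proof. by have [] := (in_L2P B).1 hB. Qed.
Let pB : periodic2pi B. Proof. by have [] := (in_L2P B).1 hB. Qed.
Let Iu : csqint u. Proof. exact: csqint_W2 hr hu. Qed.

Lemma fourier_even (k : int) : fourier u (- k) = fourier u k.
Proof.
rewrite -(fourier_reflect k Iu); suff -> : (fun x => u (- x)) = u by [].
exact/funext.
Qed.

Let lam (k : int) : R := k%:~R ^+ (2 * r) / m%:R ^+ (2 * r).

Let m2r_gt0 : 0 < m%:R ^+ (2 * r) :> R.
Proof. by rewrite exprn_gt0// ltr0n. Qed.

Let lam_ge0 k : 0 <= lam k.
Proof. by rewrite divr_ge0 ?(ltW m2r_gt0)// exprM exprn_ge0// sqr_ge0. Qed.

Let lam_ge1 k : (m <= `|k|)%N -> 1 <= lam k.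
Proof. by move=> mk; rewrite ler_pdivlMr// mul1r int_pow_le. Qed.

Let lam_gt1 k : (m < `|k|)%N -> 1 < lam k.
Proof. by move=> mk; rewrite ltr_pdivlMr// mul1r int_pow_lt. Qed.

Let lam_lt1 k : k != 0 -> (`|k| < m)%N -> 0 < lam k < 1.
Proof.
move=> k0 km; rewrite ltr_pdivrMr// mul1r int_pow_gt// andbT divr_gt0//.
by rewrite exprM exprn_gt0// exprn_even_gt0//= intr_eq0.
Qed.

(** The denominator in (4); for [k != 0] it is [((lam k)^-1 - 1) / m%:R ^+ (2 * r)]. *)
Let gap (k : int) : R := (k%:~R ^+ (2 * r))^-1 - (m%:R ^+ (2 * r))^-1.

(** A bound away from 0 that is uniform in [k]; it lets Bessel's inequality for [B] control the
    series in (4). *)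
Let gap_le (k : int) : (m < `|k|)%N ->
  gap k <= ((m.+1%:R ^+ (2 * r))^-1 - (m%:R ^+ (2 * r))^-1 : R) < 0.
Proof.
move=> mk; have h : m.+1%:R ^+ (2 * r) <= k%:~R ^+ (2 * r) :> R by exact: int_pow_le.
have m1 : 0 < m.+1%:R ^+ (2 * r) :> R by rewrite exprn_gt0.
rewrite lerD2r lef_pV2 ?posrE ?(lt_le_trans m1 h)// h /= subr_lt0 ltf_pV2 ?posrE//.
by rewrite ltrXn2r ?nnegrE ?ler0n ?ltr_nat// muln_eq0 -lt0n hr.
Qed.

(** The nearest competitor has modulus at least [2 * n - (m - 1)], which exceeds [m] because
    [m <= n]. *)
Let class_gap (l v : int) : 1 <= l <= m%:Z - 1 -> v != 0 -> (m < `|(l + 2 * n%:Z * v)%R|)%N.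
Proof. by move=> lm /(mulz_abs_ge n); rewrite -mulrA; move: (n%:Z * v) => w; lia. Qed.

Lemma partial_sum_ge0 (l : int) (N : nat) : 1 <= l <= m%:Z - 1 ->
  0 <= \sum_(0 <= i < (2 * N).+1) Normc.normc (fourier B (l + 2 * n%:Z * (i%:Z - N%:Z))) ^+ 2 /
     gap (l + 2 * n%:Z * (i%:Z - N%:Z)).
Proof.
move=> lm; pose F (v : int) : R := Normc.normc (fourier B (l + 2 * n%:Z * v)) ^+ 2 / gap (l + 2 * n%:Z * v).
set g0 : R := (m.+1%:R ^+ (2 * r))^-1 - (m%:R ^+ (2 * r))^-1.
have g00 : g0 < 0.
  by have /andP[_ ] := @gap_le (l + 2 * n%:Z * 1) (@class_gap l 1 lm isT).
have gap0 : 0 < gap (l + 2 * n%:Z * 0).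
  have l0 : l + 2 * n%:Z * 0 != 0 by lia.
  rewrite /gap subr_gt0 ltf_pV2 ?posrE//.
    by apply: int_pow_gt => //; lia.
  by rewrite exprM exprn_gt0// exprn_even_gt0//= intr_eq0.
have Fneg v : v != 0 -> F v <= 0.
  move=> v0; have /andP[h1 h2'] := gap_le (class_gap lm v0).
  by rewrite /F mulr_ge0_le0 ?sqr_ge0// invr_le0 (le_trans h1)// ltW.
apply: (le_trans (h4 lm)).
(* Replacing every denominator by the negative [g0] only lowers the terms, and Bessel bounds the sum
   of the numerators by [csqnorm B / (2 * pi)]. *)
apply: (@zsum_le_partial R F (csqnorm B / (2 * pi) / g0) N Fneg) => N'.
have pi2 : 0 < 2 * pi :> R by rewrite mulr_gt0// pi_gt0.
pose s := [seq l + 2 * n%:Z * (i%:Z - N'%:Z) | i <- index_iota 0 (2 * N').+1].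
have us : uniq s.
  by rewrite map_inj_uniq ?iota_uniq// => i j; nia.
have := bessel us IB; rewrite big_map => bs.
apply: (@le_trans _ _ (\sum_(0 <= i < (2 * N').+1)
  Normc.normc (fourier B (l + 2 * n%:Z * (i%:Z - N'%:Z))) ^+ 2 / g0)).
  rewrite -mulr_suml; apply: ler_wnM2r; first by rewrite invr_le0 ltW.
  by rewrite ler_pdivlMr// mulrC.
apply: ler_sum => i _; move: (i%:Z - N'%:Z) => v; rewrite /F.
apply: ler_wpM2l; first exact: sqr_ge0.
have [->|v0] := eqVneq v 0.
  by apply: (@le_trans _ _ 0); [rewrite invr_le0 ltW|rewrite invr_ge0 ltW].
have /andP[h1 _] := gap_le (class_gap lm v0).
by rewrite lef_nV2 ?negrE// (le_lt_trans h1).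
Qed.

(** This does not interpolate: at [k = l] the approximant gets the damped coefficient
    [(1 - lam l) * fourier u l]. The divisor is halved because taking the even part halves the
    coefficients on the class of [l]. *)
Let a (l : nat) : R[i] :=
  (1 - lam l%:Z)%:C * fourier u l%:Z / (fourier B l%:Z / 2).
Let a0 : R[i] := fourier u 0 / fourier B 0.
(** The index starts at 0: [i < m.-1] stands for the frequency [i.+1]. *)
Let Te (i : nat) : R -> R[i] := even_part (Phi B n i.+1%:Z).
Let T (x : R) : R[i] := a0 * Phi B n 0 x + \sum_(i < m.-1) a i.+1 * Te i x.

Lemma T_in_S1 : S1 B n m T.
Proof.
exists (fun x => a0 * Phi B n 0 x).
  exists 1%N, (fun=> a0), (fun=> Phi B n 0); split => // x.
  by rewrite big_ord_recl big_ord0 addr0.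
exists (fun x => \sum_(i < m.-1) a i.+1 * Te i x) => //.
exists m.-1, (fun i => a i.+1), (fun i => Te i); split => // i.
by exists i.+1%:Z => //=; have := ltn_ord i; lia.
Qed.

Let ITe i : csqint (Te i) := even_part_csqint (Phi_fourier hn IB pB i.+1%:Z 0).1.

Let IT_fT k : csqint T /\ fourier T k = a0 * fourier (Phi B n 0) k +
   \sum_(i < m.-1) a i.+1 * fourier (Te i) k.
Proof.
have IP := (Phi_fourier hn IB pB 0 0).1.
have [IS fS] := fourier_sum (index_enum _) k (fun i : 'I_m.-1 => csqintZ (a i.+1) (ITe i)).
have IaP := csqintZ a0 IP.
split; first exact: csqintD IaP IS.
rewrite /T (fourierD k IaP IS) (fourierZ a0 k IP) fS; congr (_ + _).
by apply: eq_bigr => i _; exact: fourierZ.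
Qed.

Let residue_dvd (rho v l : int) : (`|(rho - l)%R| < 2 * n)%N ->
  (2 * n%:Z %| rho + 2 * n%:Z * v - l)%Z = (rho == l).
Proof.
move=> h; have -> : rho + 2 * n%:Z * v - l = (rho - l) + (2 * n)%N%:Z * v by lia.
have -> : 2 * n%:Z = (2 * n)%N%:Z by lia.
by rewrite dvdz_small// subr_eq0.
Qed.

Let residue_dvdN (rho v l : int) : (`|(rho + l)%R| < 2 * n)%N ->
  (2 * n%:Z %| - (rho + 2 * n%:Z * v) - l)%Z = (rho == - l).
Proof.
move=> h; have -> : - (rho + 2 * n%:Z * v) - l = (- rho - l) + (2 * n)%N%:Z * (- v) by lia.
have -> : 2 * n%:Z = (2 * n)%N%:Z by lia.
by rewrite dvdz_small; [apply/eqP/eqP; lia|lia].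
Qed.

(** As [rho] lies in []-n, n]] and the frequencies [i.+1] are below [n], the numbers [rho - i.+1]
    and [rho + i.+1] are smaller than [2 * n] in modulus, so congruence becomes equality. *)
Let fT (rho v : int) : - n%:Z < rho <= n%:Z -> fourier T (rho + 2 * n%:Z * v) =
  a0 * (if rho == 0 then fourier B (rho + 2 * n%:Z * v) else 0) +
  \sum_(i < m.-1) a i.+1 * (((if rho == i.+1%:Z then fourier B (rho + 2 * n%:Z * v) else 0) +
     (if rho == - i.+1%:Z then fourier B (- (rho + 2 * n%:Z * v)) else 0)) / 2).
Proof.
move=> hrho; rewrite (IT_fT _).2 (Phi_fourier hn IB pB 0 _).2 residue_dvd; last by lia.
congr (_ + _); apply: eq_bigr => i _; have im := ltn_ord i.
have IP := (Phi_fourier hn IB pB i.+1%:Z 0).1.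
rewrite /Te (fourier_even_part _ IP) !(Phi_fourier hn IB pB i.+1%:Z _).2.
by rewrite residue_dvd ?residue_dvdN//; lia.
Qed.

(** Condition (3) leaves [Phi B n 0] only the frequency 0, so the mean of [u] is matched at no cost
    elsewhere. *)
Let fT0 (v : int) : fourier T (2 * n%:Z * v) = if v == 0 then fourier u 0 else 0.
Proof.
have h : - n%:Z < 0 <= n%:Z by lia.
have := fT v h; rewrite add0r eqxx => ->.
rewrite big1 ?addr0.
  case: eqVneq => [->|v0]; last by rewrite h3// mulr0.
  by rewrite mulr0 /a0 divfK// h2//; lia.
move=> i _; rewrite (_ : (0 == i.+1%:Z) = false)//.
by rewrite (_ : (0 == - i.+1%:Z) = false)// addr0 mul0r mulr0.
Qed.

Let fT_class (l : nat) (v : int) : (0 < l < m)%N ->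
  fourier T (l%:Z + 2 * n%:Z * v) = a l * (fourier B (l%:Z + 2 * n%:Z * v) / 2) /\
  fourier T (- l%:Z + 2 * n%:Z * v) = a l * (fourier B (- (- l%:Z + 2 * n%:Z * v)) / 2).
Proof.
move=> lm; have lm1 : (l.-1 < m.-1)%N by lia.
have l0 : (l%:Z == 0) = false by lia.
have nl0 : (- l%:Z == 0) = false by lia.
have sum1 (G : 'I_m.-1 -> R[i]) : (forall i, i != Ordinal lm1 -> G i = 0) ->
    \sum_i G i = G (Ordinal lm1).
  by move=> G0; rewrite (bigD1 (Ordinal lm1))//= big1 ?addr0.
have neq (i : 'I_m.-1) : i != Ordinal lm1 -> i.+1 <> l.
  by move=> /eqP il E; apply: il; apply: val_inj => /=; lia.
split; (rewrite fT; last by lia); rewrite ?l0 ?nl0 mulr0 add0r sum1.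
- rewrite [nat_of_ord _]/= prednK; last by lia.
  by rewrite eqxx (_ : (l%:Z == - l%:Z) = false) ?addr0//; lia.
- move=> i /neq il; rewrite (_ : (l%:Z == i.+1%:Z) = false); last by lia.
  by rewrite (_ : (l%:Z == - i.+1%:Z) = false) ?addr0 ?mul0r ?mulr0//; lia.
- rewrite [nat_of_ord _]/= prednK; last by lia.
  by rewrite eqxx (_ : (- l%:Z == l%:Z) = false) ?add0r//; lia.
- move=> i /neq il; rewrite (_ : (- l%:Z == i.+1%:Z) = false); last by lia.
  by rewrite (_ : (- l%:Z == - i.+1%:Z) = false) ?addr0 ?mul0r ?mulr0//; lia.
Qed.

Let fT_other (rho v : int) : - n%:Z < rho <= n%:Z -> (m <= `|rho|)%N ->
  fourier T (rho + 2 * n%:Z * v) = 0.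
Proof.
move=> h mr; rewrite fT//.
rewrite (_ : (rho == 0) = false) ?mulr0 ?add0r; last by lia.
rewrite big1// => i _; have im := ltn_ord i.
rewrite (_ : (rho == i.+1%:Z) = false); last by lia.
by rewrite (_ : (rho == - i.+1%:Z) = false) ?addr0 ?mul0r ?mulr0//; lia.
Qed.

Let resid (k : int) : R := Normc.normc (fourier u k - fourier T k) ^+ 2.
Let weight (k : int) : R := lam k * Normc.normc (fourier u k) ^+ 2.

Let trivial_residual k : (m <= `|k|)%N -> fourier T k = 0 -> resid k <= weight k.
Proof.
move=> mk Tk; rewrite /resid /weight Tk subr0 ler_peMl ?sqr_ge0//; exact: lam_ge1.
Qed.

Let class_sum (l N : nat) : (0 < l < m)%N ->
  \sum_(0 <= j < (2 * N).+1) resid (l%:Z + 2 * n%:Z * (j%:Z - N%:Z)) <=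
  \sum_(0 <= j < (2 * N).+1) weight (l%:Z + 2 * n%:Z * (j%:Z - N%:Z)).
Proof.
move=> lm; have lmz : 1 <= l%:Z <= m%:Z - 1 by lia.
pose k (v : int) : int := l%:Z + 2 * n%:Z * v.
have k0 : k 0 = l%:Z by rewrite /k mulr0 addr0.
have B0 : fourier B l%:Z / 2 != 0.
  by rewrite mulf_neq0 ?invr_eq0 ?pnatr_eq0// h2//; lia.
have := @class_inequality R (fun v => fourier u (k v)) (fun v => fourier B (k v) / 2) (a l)
  (fun v => lam (k v)) N.
rewrite !k0 /resid /weight => H.
rewrite (eq_bigr (fun i : nat => Normc.normc (fourier u (k (i%:Z - N%:Z)) -
  a l * (fourier B (k (i%:Z - N%:Z)) / 2)) ^+ 2)); last first.
  by move=> i _; rewrite (fT_class _ lm).1.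
apply: H => //.
- by apply: lam_lt1; lia.
- by move=> v v0; apply: lam_gt1; exact: class_gap.
- have := partial_sum_ge0 N lmz.
  (* The 4 comes from the halved coefficients of [B], the power of [m] from turning [gap] into
     [lam^-1 - 1]. *)
  rewrite -(pmulr_rge0 _ (_ : 0 < (4 * m%:R ^+ (2 * r))^-1 :> R)); last first.
    by rewrite invr_gt0 mulr_gt0.
  rewrite mulr_sumr.
  have E (v : int) : (4 * m%:R ^+ (2 * r))^-1 * (Normc.normc (fourier B (l%:Z + 2 * n%:Z * v)) ^+ 2 /
      gap (l%:Z + 2 * n%:Z * v)) = Normc.normc (fourier B (k v) / 2) ^+ 2 / ((lam (k v))^-1 - 1).
    rewrite -/(k v) (normc_sqM (fourier B (k v)) 2^-1) /gap /lam.
    have -> : Normc.normc (2^-1 : R[i]) ^+ 2 = 4^-1 :> R.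
      rewrite (_ : 2^-1 = (2^-1)%:C); last by rewrite fmorphV rmorph_nat.
      by rewrite normc_sqr_real; field.
    have kv0 : k v != 0.
      rewrite /k; have [->|/(mulz_abs_ge n)] := eqVneq v 0; first by lia.
      by rewrite -mulrA; move: (n%:Z * v) => w; lia.
    have km : (k v)%:~R ^+ (2 * r) != 0 :> R by rewrite expf_neq0// intr_eq0.
    have m0 : m%:R ^+ (2 * r) != 0 :> R by rewrite gt_eqF.
    move: (_ ^+ (2 * r)) (_ ^+ (2 * r)) km m0 => K M km m0.
    have -> : (M / K)^-1 - 1 = K * (M^-1 - K^-1) by field; rewrite m0 km.
    by rewrite !invfM; ring.
  by under eq_bigr do rewrite E.
Qed.

Let window_sum (N i : nat) : (i < 2 * n)%N ->
  \sum_(0 <= j < (2 * N).+1) resid (window_index n N i j) <=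
  \sum_(0 <= j < (2 * N).+1) weight (window_index n N i j).
Proof.
move=> i2; rewrite /window_index; set rho : int := i%:Z - n%:Z + 1.
have hrho : - n%:Z < rho <= n%:Z by rewrite /rho; lia.
(* Then the whole class has modulus at least [m]: for [v != 0], subtracting [|rho| <= n] from at
   least [2 * n] leaves at least [n]. *)
have [mr|mr] := leqP m `|rho|.
  apply: ler_sum => j _; apply: trivial_residual; last exact: fT_other.
  move: (j%:Z - N%:Z) => v.
  have [->|/(mulz_abs_ge n)] := eqVneq v 0; first by rewrite mulr0 addr0.
  by rewrite -mulrA; move: (n%:Z * v) => w; lia.
have [rho0|rho0] := eqVneq rho 0.
  apply: ler_sum => j _; rewrite rho0 add0r; move: (j%:Z - N%:Z) => v.
  have [->|v0] := eqVneq v 0.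
    have := fT0 0; rewrite eqxx mulr0 /resid /weight => ->.
    by rewrite subrr Normc.normc0 expr0n mulr_ge0// sqr_ge0.
  apply: trivial_residual; last by rewrite fT0 (negbTE v0).
  by have := mulz_abs_ge n v0; rewrite -mulrA; move: (n%:Z * v) => w; lia.
pose l := `|rho|%N; have lm : (0 < l < m)%N by rewrite /l; lia.
have [rl|rl] : rho = l%:Z \/ rho = - l%:Z by rewrite /l; lia.
  by rewrite rl; exact: class_sum.
(* Remaining case [rho = - l]: reversing the symmetric sum sends each index to the opposite of one
   in the class of [rho], and [resid] and [weight] agree at opposite indices since [u] and the
   chosen summands are even. *)
have := class_sum N lm.
rewrite -(symmetric_sumN (fun v => resid (l%:Z + 2 * n%:Z * v))).
rewrite -(symmetric_sumN (fun v => weight (l%:Z + 2 * n%:Z * v))).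
have E (v : int) : l%:Z + 2 * n%:Z * (- v) = - (rho + 2 * n%:Z * v) by lia.
have Ew (v : int) : weight (l%:Z + 2 * n%:Z * (- v)) = weight (rho + 2 * n%:Z * v).
  by rewrite E /weight fourier_even /lam mulrNz !exprM sqrrN.
have Er (v : int) : resid (l%:Z + 2 * n%:Z * (- v)) = resid (rho + 2 * n%:Z * v).
  by rewrite /resid {2}rl (fT_class _ lm).1 (fT_class _ lm).2 E fourier_even rl.
under eq_bigr do rewrite Er.
by under [leRHS]eq_bigr do rewrite Ew.
Qed.

(** Parseval serves only for [u - T], to bound its norm by a sum over a window; for the derivative
    of [u] the opposite inequality is wanted, and that is Bessel's. *)
Lemma csqnorm_residual : csqnorm (fun x => u x - T x) <=
  (m%:R ^+ (2 * r))^-1 * csqnorm (cderiv r u).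
Proof.
have IT := (IT_fT 0).1; have Id := csqintB Iu IT.
have Iur : csqint (cderiv r u) by case: hu => _ _ _ /in_L2P[].
apply/ler_addgt0Pr => e e0; have [s0 H] := parseval Id e0.
have [N sN] := subset_window hn s0.
apply: (le_trans (H _ (window_uniq hn N) sN)); rewrite lerD2r.
have bs := bessel (window_uniq hn N) Iur.
apply: (@le_trans _ _ ((m%:R ^+ (2 * r))^-1 * (2 * pi *
   \sum_(k <- window n N) Normc.normc (fourier (cderiv r u) k) ^+ 2))); last first.
  by rewrite ler_wpM2l// invr_ge0 ltW.
rewrite mulrCA ler_wpM2l ?mulr_ge0 ?pi_ge0// mulr_sumr.
rewrite (eq_bigr resid); last by move=> k _; rewrite (fourierB k Iu IT).
rewrite [leRHS](eq_bigr weight); last first.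
  by move=> k _; rewrite (normc_fourier_cderiv k hr hu) mulrA [_^-1 * _]mulrC.
rewrite !sum_window big_nat [leRHS]big_nat; apply: ler_sum => i /andP[_ i2].
exact: window_sum.
Qed.

Lemma best_approx2_S1 : best_approx2 u (S1 B n m) <= (m%:R ^+ r)^-1 * norm2 (cderiv r u).
Proof.
apply: (@le_trans _ _ (norm2 (fun x => u x - T x))).
  apply: ge_inf; last by exists T => //; exact: T_in_S1.
  (* The set of distances is bounded below by 0, so its [inf] is a genuine infimum. *)
  by exists 0 => _ [S _ <-]; rewrite sqrtr_ge0.
rewrite !norm2E; have mr0 : 0 <= (m%:R ^+ r)^-1 :> R by rewrite invr_ge0 exprn_ge0.
rewrite -{1}(ger0_norm mr0) -sqrtr_sqr -sqrtrM ?sqr_ge0// ler_wsqrtr//.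
by rewrite -exprVn -exprM mulnC exprVn; exact: csqnorm_residual.
Qed.

End main.

Theorem theorem3 (R : realType) (r n m : nat) (B : R -> R[i])
    (hr : (0 < r)%N) (hn : (0 < n)%N) (hm : (0 < m)%N) (hmn : (m <= n)%N)
    (hB : in_L2 B)
    (h1 : forall l : int, 1 <= l <= m%:Z - 1 ->
       exists2 gam : R[i], gam != 0 &
         forall k : int, fourier B (- l - 2 * n%:Z * k) =
                         gam * fourier B (l + 2 * n%:Z * k))
    (h2 : forall l : int, 0 <= l <= m%:Z - 1 -> fourier B l != 0)
    (h3 : forall nu : int, nu != 0 -> fourier B (2 * n%:Z * nu) = 0)
    (h4 : forall l : int, 1 <= l <= m%:Z - 1 ->
       0 <= zsum (fun k : int =>
              Normc.normc (fourier B (l + 2 * n%:Z * k)) ^+ 2 /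
              (((l + 2 * n%:Z * k)%:~R ^+ (2 * r))^-1
               - (m%:R ^+ (2 * r))^-1) : R))
    (u : R -> R[i]) (hu : in_W2 r u) (hue : forall x, u (- x) = u x) :
  best_approx2 u (S1 B n m) <= (m%:R ^+ r)^-1 * norm2 (cderiv r u).
Proof. exact: best_approx2_S1. Qed.
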